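(* For each $0<\alpha<1$ and any interval $\mathfrak{I}\subseteq\mathsf{T}$ we have: (i) for $d=2$, $$\dim\mathscr{D}_{\alpha,2}(\mathfrak{I})\ge\min\{1,\ 2(1-\alpha)\};$$ (ii) for every integer $d\ge3$, $$\dim\mathscr{D}_{\alpha,d}(\mathfrak{I})\ge\left(1+\frac1d\right)\min\left\{\frac{2}{d+2},\ 1-\alpha\right\}.$$
   Context: $\mathsf{T}=\mathbb{R}/\mathbb{Z}$ is identified with $[0,1)$; intervals have positive length. For a sequence $(x_n)_{n\in\mathbb{N}}$ in $[0,1)$ its (unnormalized) discrepancy at length $N$ is $$D_N=\sup_{0\le a<b\le1}\bigl|\#\{1\le n\le N:\ x_n\in(a,b)\}-(b-a)N\bigr|.$$ For $x\in[0,1)$, $\Delta_d(x;N)$ denotes the discrepancy at length $N$ of the sequence of fractional parts of $xn^d$, $n\in\mathbb{N}$. Define $$\mathscr{D}_{\alpha,d}=\{x\in[0,1):\ \Delta_d(x;N)\ge N^{\alpha}\text{ for infinitely many }N\in\mathbb{N}\},\qquad\mathscr{D}_{\alpha,d}(\mathfrak{I})=\mathscr{D}_{\alpha,d}\cap\mathfrak{I}.$$ $\dim$ denotes the Hausdorff dimension. *)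

(* Defs.v *)
From mathcomp Require Export all_boot all_order all_algebra.
From mathcomp Require Export all_classical all_reals all_analysis.
Export Order.TTheory GRing.Theory Num.Theory.
Export numFieldNormedType.Exports.

Set Implicit Arguments.
Unset Strict Implicit.
Unset Printing Implicit Defensive.

Local Open Scope classical_set_scope.
Local Open Scope ring_scope.

Section hausdorff_dimension.
Context {R : realType}.
Implicit Types (s delta : R) (A E : set R).

(* The diameter of the empty set is -oo here. *)
Definition diameter A : \bar R :=
  ereal_sup [set `|p.1 - p.2|%:E | p in A `*` A].

(* (diam A)^s, where the empty set contributes 0 even for s = 0 while a
   singleton contributes 0 `^ 0 = 1: the 0-dimensional measure counts points. *)
Definition diameter_pow s A : \bar R :=
  if A == set0 then 0%E else poweR (diameter A) s.

Definition hausdorff_content s delta E : \bar R :=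
  ereal_inf [set (\sum_(0 <= i <oo) diameter_pow s (U i))%E | U in
    [set U : (set R)^nat | E `<=` \bigcup_i U i /\
                           forall i, (diameter (U i) <= delta%:E)%E]].

Definition hausdorff_measure s E : \bar R :=
  ereal_sup [set hausdorff_content s delta E | delta in [set delta | 0 < delta]].

Definition hausdorff_dim E : \bar R :=
  ereal_inf [set s%:E | s in [set s | 0 <= s /\ hausdorff_measure s E = 0%E]].

End hausdorff_dimension.

Section discrepancy.
Context {R : realType}.
Implicit Types (x alpha : R) (u : R^nat) (I : set R) (d N : nat).

Definition fracpart x : R := x - (Num.floor x)%:~R.

(* Intervals of R/Z: images of the intervals of R of positive length, with
   R/Z identified with [0, 1) through the fractional part. These are the
   subintervals of [0, 1) of positive length, and the arcs through 0. *)
Definition torus_interval I : Prop :=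
  exists J : set R, [/\ is_interval J,
    exists a b, [/\ J a, J b & a < b] & I = fracpart @` J].

(* The sequence is indexed from 1: u 0 plays no role. *)
Definition discrepancy u N : R :=
  sup [set `|(count (fun n => p.1 < u n < p.2) (index_iota 1 N.+1))%:R
             - (p.2 - p.1) * N%:R| | p in
       [set p : R * R | 0 <= p.1 < p.2 /\ p.2 <= 1]].

Definition monomial_discrepancy d x N : R :=
  discrepancy (fun n => fracpart (x * n%:R ^+ d)) N.

Definition large_discrepancy_set alpha d : set R :=
  [set x | 0 <= x < 1 /\
    infinite_set [set N | (0 < N)%N /\
                          N%:R `^ alpha <= monomial_discrepancy d x N]].

End discrepancy.

(* Main.v *)
Require Import Defs.
From mathcomp Require Import ring lra zify.
Import Order.TTheory GRing.Theory Num.Theory.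

(** If [x] is very close to a fraction [a / p^e] with [p] prime, the exponential
    sum of [x n^d] over [n <= N = K p] is close to the one at [a / p^e], and its
    modulus bounds the discrepancy from below (Koksma).  For [d = 2], [e = 1]
    this is a Gauss sum of modulus [K sqrt p].  For [e = d >= 3] the multiples of
    [p] contribute [K], while the second moment over [a] shows that the other
    terms are negligible for most [a]; the same second moment, with partial
    summation, controls the passage from [a / p^e] to [x].

    Let [p] run over the primes in [(Y, X]], with [Y = X^(1 - o(1))].  Most of
    these fractions are isolated at the scale of their mean spacing, because
    [a q' - a' q] determines [(a, a')] for coprime [q], [q'].  Hence every
    interval contains about its expected number of good, well spaced fractions.
    Given a countable cover with a small sum of [s]-th powers of diameters, one
    descends through nested neighbourhoods of such fractions, choosing each time,
    by averaging, a neighbourhood that meets no long set of the cover and little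
    of the short ones; the limit point is not covered.  This bounds the Hausdorff
    content from below without constructing a measure. *)

Set Implicit Arguments.
Unset Strict Implicit.
Unset Printing Implicit Defensive.

(** * Primes in short ranges *)

(** Exponents, up to factors X^o(1). There are about X^(e+1) fractions a / p^e. With K = X^k, a
    phase that stays small up to N = K p allows neighbourhoods of radius (K X)^(-d), so the
    dimension reached is (e + 1) / (d (1 + k)), and k should be as small as the discrepancy permits.
    For d = 2, the condition K sqrt p > (K p)^alpha asks for k (1 - alpha) > alpha - 1/2 and yields
    2 (1 - alpha). For d >= 3, K > (K p)^alpha asks for k (1 - alpha) > alpha and yields (1 + 1/d)
    (1 - alpha). In that case the multiples of p dominate only if K is much larger than p, so k > 1
    is required; an exponent above 1/2 ensures it. A smaller alpha is first raised above 1/2, which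
    shrinks the set, and the caps 1 and 2 / (d + 2) leave room for that. All inequalities between
    exponents are strict, because the lower bound is only tested on each s below it. The spare power
    of X pays for the constants, for a weak Chebyshev count of primes, and for the interval to be
    subdivided, which may be very short but is fixed before X is chosen. *)

Lemma divn_double_le m q : 0 < q -> m.*2 %/ q <= (m %/ q).*2 + (q <= m.*2).
Proof.
move=> q0; case: (leqP q m.*2) => [_|h]; last by rewrite divn_small.
rewrite -ltnS ltn_divLR //.
have := divn_eq m q; have := ltn_pmod m q0.
set a := m %/ q; set r := m %% q => ? ->; nia.
Qed.

Lemma count_split (T : Type) (a b : pred T) (s : seq T) :
  count a s = count [pred x | a x & b x] s + count [pred x | a x & ~~ b x] s.
Proof. by elim: s => //= x s ->; case: (a x); case: (b x) => /=; lia. Qed.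

(** Legendre's formula: each power [p ^ k <= 2m] adds at most one to the exponent of [p] in the
    central binomial coefficient, and there are at most [trunc_log p (2m)] such powers. *)
Lemma logn_bin_le p m : prime p -> 0 < m -> p ^ logn p 'C(m.*2, m) <= m.*2.
Proof.
move=> pp m0; have p1 := prime_gt1 pp.
apply: leq_trans (trunc_logP p1 _); last by rewrite double_gt0.
rewrite leq_exp2l //.
have le2 : m <= m.*2 by rewrite -addnn leq_addr.
have mm : m.*2 - m = m by rewrite -addnn addnK.
have := congr1 (logn p) (bin_fact le2); rewrite mm.
rewrite !lognM ?muln_gt0 ?fact_gt0 ?bin_gt0 //.
rewrite !logn_fact //.
have -> : \sum_(1 <= k < m.+1) m %/ p ^ k = \sum_(1 <= k < m.*2.+1) m %/ p ^ k.
  rewrite [RHS](big_cat_nat (n := m.+1)) //=.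
  rewrite [X in _ = _ + X]big_nat_cond [X in _ = _ + X]big1 ?addn0 // => k.
  rewrite andbT => /andP[mk _]; rewrite divn_small //.
  by apply: ltn_trans mk _; exact: ltn_expl.
move=> E.
have : \sum_(1 <= k < m.*2.+1) m.*2 %/ p ^ k <=
   \sum_(1 <= k < m.*2.+1) ((m %/ p ^ k).*2 + (k <= trunc_log p m.*2)).
  apply: leq_sum => k _; have pk : 0 < p ^ k by rewrite expn_gt0 ltnW.
  apply: leq_trans (divn_double_le m pk) _; rewrite leq_add2l.
  by case E1: (p ^ k <= m.*2) => //; rewrite trunc_log_max.
rewrite big_split /= -E.
rewrite -(big_morph double doubleD (erefl 0.*2 : 0.*2 = 0)).
have : \sum_(1 <= k < m.*2.+1) (k <= trunc_log p m.*2) <= trunc_log p m.*2.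
  set t := trunc_log _ _.
  rewrite -big_mkcond /= sum1_count.
  rewrite -size_filter -[X in _ <= X](size_iota 1 t).
  apply: uniq_leq_size; first by rewrite filter_uniq // iota_uniq.
  by move=> k; rewrite mem_filter mem_index_iota mem_iota => /and3P[? ? _]; lia.
lia.
Qed.

Lemma bin_double_ge m : 2 ^ m <= 'C(m.*2, m).
Proof.
elim: m => // m IH; rewrite doubleS binS.
rewrite expnS mul2n -addnn; apply: leq_add; apply: leq_trans IH _.
  by rewrite binS leq_addl.
by rewrite leq_bin2l.
Qed.

(** Only primes up to [2m] divide the coefficient, and each contributes a prime power of at most
    [2m]. *)
Lemma bin_double_le_primepi m : 0 < m ->
  'C(m.*2, m) <= m.*2 ^ count prime (iota 0 m.*2.+1).
Proof.
move=> m0; set c := 'C(_, _).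
have c0 : 0 < c by rewrite bin_gt0 -addnn leq_addr.
rewrite [X in X <= _](prod_prime_decomp c0) prime_decompE big_map /=.
apply: (@leq_trans (m.*2 ^ size (primes c))).
  rewrite -[size _]count_predT -[X in _ <= X]iter_muln_1 -big_const_seq.
  rewrite big_seq [X in _ <= X]big_seq.
  apply: leq_prod => p; rewrite mem_primes => /and3P[pp _ _].
  exact: logn_bin_le.
rewrite leq_pexp2l ?double_gt0 // -size_filter.
apply: uniq_leq_size; first exact: primes_uniq.
move=> p; rewrite mem_primes mem_filter mem_iota => /and3P[pp _ pc].
rewrite pp prime_gt0 //= add1n ltnS; apply: leq_trans (logn_bin_le pp m0).
rewrite -[X in X <= _]expn1 leq_exp2l ?prime_gt1 //.
by rewrite logn_gt0 mem_primes pp c0.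
Qed.

(** Chebyshev's bound with [X = 2 ^ (b * j)] and [Y = 2 ^ (b.-1 * j)], powers of 2 so that
    logarithms are exact. From [2 ^ (X / 2) <= X ^ pi(X)] one gets [pi(X) >= X / (2 b j)], which
    exceeds [2 Y] because [X / Y = 2 ^ j > 4 b j]; at most [Y] of these primes are up to [Y]. *)
Lemma count_primes_dyadic b j : 0 < b -> 0 < j -> 4 * (b * j) < 2 ^ j ->
  2 ^ (b.-1 * j) <=
  count [pred p | prime p & 2 ^ (b.-1 * j) < p] (iota 0 (2 ^ (b * j)).+1).
Proof.
move=> b0 j0 bj; set Y := 2 ^ _.
have XE : 2 ^ (b * j) = Y * 2 ^ j.
  by rewrite /Y -expnD -mulSnr prednK.
have bj0 : 0 < b * j by rewrite muln_gt0 b0.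
set m := 2 ^ (b * j).-1.
have mE : m.*2 = 2 ^ (b * j) by rewrite -mul2n -expnS prednK.
have m0 : 0 < m by rewrite expn_gt0.
have := leq_trans (bin_double_ge m) (bin_double_le_primepi m0).
rewrite mE -expnM leq_exp2l //; set pi := count prime _ => h.
have h1 : Y.*2 <= pi.
  rewrite leqNgt; apply/negP => h2.
  have h3 : m.*2 <= (b * j * pi).*2 by rewrite leq_double.
  rewrite mE XE in h3.
  have : b * j * pi < b * j * Y.*2 by rewrite ltn_pmul2l.
  have Y0 : 0 < Y by rewrite expn_gt0.
  have : Y * (4 * (b * j)) < Y * 2 ^ j by rewrite ltn_pmul2l.
  nia.
have h2 : count [pred p | prime p & p <= Y] (iota 0 (2 ^ (b * j)).+1) <= Y.
  rewrite -size_filter -[X in _ <= X](size_iota 1 Y).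
  apply: uniq_leq_size; first by rewrite filter_uniq ?iota_uniq.
  move=> p; rewrite mem_filter !mem_iota /= => /andP[/andP[/prime_gt0]].
  lia.
have h3 := count_split prime (fun p => p <= Y) (iota 0 (2 ^ (b * j)).+1).
have h4 : count [pred p | prime p & ~~ (p <= Y)] (iota 0 (2 ^ (b * j)).+1)
  = count [pred p | prime p & Y < p] (iota 0 (2 ^ (b * j)).+1).
  by apply: eq_count => p /=; rewrite ltnNge.
by rewrite -/pi h4 in h3; lia.
Qed.

(** * Congruences between [d]-th powers *)

(* [r^d - t^d] factors as [(r - t) S] with [S = d r^(d-1)] modulo [p], a unit. *)
Lemma eqn_mod_pow_lift p e d r t : prime p -> ~~ (p %| d) -> ~~ (p %| r) ->
  r ^ d = t ^ d %[mod p ^ e] -> r = t %[mod p] -> r = t %[mod p ^ e].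
Proof.
move=> pp pd; wlog le_tr : r t / t <= r.
  move=> H pr h1 h2; case: (leqP t r) => [le|/ltnW le]; first exact: H.
  apply/esym; apply: H => //.
  by rewrite /dvdn -h2.
move=> pr /eqP h1 /eqP h2; apply/eqP; move: h1.
rewrite !eqn_mod_dvd //; last first.
  by rewrite leq_exp2r // lt0n; apply: contraNneq pd => ->; rewrite dvdn0.
rewrite subn_exp Gauss_dvdl //.
rewrite coprimeXl // prime_coprime //.
rewrite /dvdn -modn_summ.
have -> : \sum_(i < d) (r ^ (d.-1 - i) * t ^ i) %% p = \sum_(i < d) (r ^ d.-1 %% p).
  apply: eq_bigr => i _.
  rewrite -modnMmr -modnXm -(eqP h2) modnXm modnMmr -expnD subnK //.
  by have := ltn_ord i; lia.
rewrite sum_nat_const card_ord modnMmr -/(dvdn _ _) Euclid_dvdM // negb_or pd.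
by apply: contra pr; rewrite Euclid_dvdX // => /andP[].
Qed.

(** Reduction modulo [p] is injective on the solutions by [eqn_mod_pow_lift], and their images are
    roots of [X^d - i^d] over the field ['F_p]. *)
Lemma count_pow_eq_mod p e d i : prime p -> ~~ (p %| d) -> ~~ (p %| i) ->
  0 < e -> count (fun r => i ^ d == r ^ d %[mod p ^ e]) (iota 0 (p ^ e)) <= d.
Proof.
move=> pp pd pi e0.
have d0 : 0 < d by rewrite lt0n; apply: contraNneq pd => ->; rewrite dvdn0.
have pq : p %| p ^ e by rewrite dvdn_exp.
have modp m n : m = n %[mod p ^ e] -> m = n %[mod p].
  by move=> h; rewrite -(modn_dvdm m pq) h modn_dvdm.
have Feq m n : (m%:R == n%:R :> 'F_p)%R = (m == n %[mod p]).
  by rewrite -val_eqE /= !val_Fp_nat //.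
rewrite -size_filter; set rs := seq.filter _ _.
have rsP r : r \in rs -> i ^ d = r ^ d %[mod p ^ e] /\ r < p ^ e.
  by rewrite mem_filter mem_iota => /andP[/eqP ? /andP[_ ?]].
rewrite -(size_map (fun r => r%:R : 'F_p)%R rs) -ltnS.
have sz := @size_XnsubC 'F_p d (i ^ d)%:R%R d0.
rewrite -sz; apply: max_poly_roots.
- by rewrite -size_poly_eq0 sz.
- apply/allP => _ /mapP[r /rsP[h _] ->].
  rewrite rootE !hornerE subr_eq0 -natrX Feq.
  by apply/eqP/esym/modp.
- rewrite map_inj_in_uniq ?filter_uniq ?iota_uniq // => r t /rsP[hr lr] /rsP[ht lt].
  move/eqP; rewrite Feq => /eqP rt.
  rewrite -(modn_small lr) -(modn_small lt).
  apply: (eqn_mod_pow_lift pp pd _ _ rt); last by rewrite -hr.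
  have: ~~ (p %| r ^ d).
    rewrite /dvdn -(modp _ _ hr) -/(dvdn _ _).
    by apply: contra pi; rewrite Euclid_dvdX // => /andP[].
  by rewrite Euclid_dvdX // d0 andbT.
Qed.

Lemma sum_nat_count (T : Type) (P : pred T) (s : seq T) :
  \sum_(j <- s) P j = count P s.
Proof. by rewrite -sum1_count [RHS]big_mkcond. Qed.

Lemma count_periodic (P : pred nat) q k :
  count (fun j => P (j %% q)) (iota 0 (k * q)) = k * count P (iota 0 q).
Proof.
elim: k => [|k IH]; first by rewrite !mul0n.
rewrite !mulSnr iotaD count_cat IH add0n; congr addn.
rewrite -[k * q]addn0 iotaDl count_map; apply: eq_in_count => j.
by rewrite mem_iota => /andP[_ jq] /=; rewrite ?modnMDl ?addn0 modn_small.
Qed.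

Lemma count_pow_eq_mod_le p e d i n : prime p -> ~~ (p %| d) -> ~~ (p %| i) ->
  0 < e -> count (fun j => i ^ d == j ^ d %[mod p ^ e]) (index_iota 1 n.+1)
   <= (n %/ p ^ e).+1 * d.
Proof.
move=> pp pd pi e0; set q := p ^ e.
have q0 : 0 < q by rewrite expn_gt0 prime_gt0.
apply: (@leq_trans (count (fun j => i ^ d == j ^ d %[mod q])
  (iota 0 ((n %/ q).+1 * q)))).
  apply: leq_count_subseq; rewrite /index_iota subn1 /=.
  have : n.+1 <= (n %/ q).+1 * q by apply: ltn_ceil.
  move=> h; rewrite -(subnKC h) iotaD.
  by apply: subseq_trans (prefix_subseq _ _); exact: subseq_cons.
rewrite (@eq_count _ _ (fun j => i ^ d == (j %% q) ^ d %[mod q])); last first.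
  by move=> j; rewrite modnXm.
by rewrite (count_periodic (fun r => i ^ d == r ^ d %[mod q])) leq_mul2l count_pow_eq_mod ?orbT.
Qed.

Lemma count_dvdn p n :
  count (fun j => p %| j) (index_iota 1 n.+1) = n %/ p.
Proof. by rewrite divn_count_dvd sum_nat_count. Qed.

Lemma sum_pow_eq_mod_le p e d n : prime p -> ~~ (p %| d) -> 0 < e ->
  \sum_(i <- index_iota 1 n.+1) \sum_(j <- index_iota 1 n.+1)
     (i ^ d == j ^ d %[mod p ^ e])
   <= n * ((n %/ p ^ e).+1 * d) + (n %/ p) ^ 2.
Proof.
move=> pp pd e0; rewrite (bigID (fun i => p %| i)) /= addnC; apply: leq_add.
  apply: (@leq_trans (\sum_(i <- index_iota 1 n.+1 | ~~ (p %| i)) (n %/ p ^ e).+1 * d)).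
    by apply: leq_sum => i pi; rewrite sum_nat_count count_pow_eq_mod_le.
  rewrite big_const_seq iter_addn_0 mulnC leq_mul2r.
  by rewrite (leq_trans (count_size _ _)) ?orbT // size_iota subn1.
rewrite -mulnn -{1}(count_dvdn p n) -sum1_count big_distrl /=.
apply: leq_sum => i pi; rewrite mul1n sum_nat_count -count_dvdn.
apply: sub_count => j /eqP /= h.
have d0 : 0 < d by rewrite lt0n; apply: contraNneq pd => ->; rewrite dvdn0.
suff: p %| j ^ d by rewrite Euclid_dvdX // => /andP[].
have pq : p %| p ^ e by rewrite dvdn_exp.
by rewrite /dvdn -(modn_dvdm _ pq) -h modn_dvdm // -/(dvdn _ _) dvdn_exp.
Qed.

Local Open Scope classical_set_scope.
Local Open Scope ring_scope.

(** * Koksma inequality *)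

Section Koksma.
Context {R : realType}.
Implicit Types (x y : R) (f : R -> R) (u : R^nat).

Lemma natr_count (T : Type) (P : pred T) (s : seq T) :
  (count P s)%:R = \sum_(x <- s) (P x)%:R :> R.
Proof. by elim: s => [|x s IH]; rewrite ?big_nil // big_cons /= natrD IH. Qed.

Lemma lipschitz_of_derive_le1 f df : (forall x, is_derive x 1 f (df x)) ->
  (forall x, `|df x| <= 1) -> forall x y, `|f x - f y| <= `|x - y|.
Proof.
move=> fd f1 x y; wlog xy : x y / x <= y.
  by move=> H; case: (leP x y) => [|/ltW] /H //; rewrite distrC [X in _ <= X]distrC.
have [|c _ h] := @MVT_segment R f df x y xy (fun z _ => fd z).
  apply: continuous_subspaceT => z; apply: differentiable_continuous.
  by apply/derivable1_diffP; exact: (@ex_derive _ _ _ _ _ _ _ (fd z)).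
by rewrite distrC h normrM [X in _ <= X]distrC ler_piMl.
Qed.

Lemma cos_lipschitz x y : `|cos x - cos y| <= `|x - y|.
Proof.
apply: (@lipschitz_of_derive_le1 _ (fun z => - sin z)) => z.
by rewrite normrN sin_max.
Qed.

Lemma sin_lipschitz x y : `|sin x - sin y| <= `|x - y|.
Proof.
apply: (@lipschitz_of_derive_le1 _ cos) => z.
exact: cos_max.
Qed.

Lemma sumr_abel (a b : R^nat) n :
  \sum_(j < n) a j * (b j.+1 - b j) =
  a n * b n - a 0%N * b 0%N - \sum_(j < n) b j.+1 * (a j.+1 - a j).
Proof.
elim: n => [|n IH]; first by rewrite !big_ord0; ring.
by rewrite !big_ord_recr /= IH; ring.
Qed.

Lemma sumr_const_iota N x : \sum_(1 <= n < N.+1) x = x * N%:R.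
Proof. by rewrite big_const_nat subn1 iter_addr_0 mulr_natr. Qed.

Section Discrepancy.
Variables (u : R^nat) (N : nat).
Hypothesis u01 : forall n, 0 <= u n < 1.
Let s := index_iota 1 N.+1.
Let D := discrepancy u N.

Lemma discrepancy_ge a b : 0 <= a -> a < b -> b <= 1 ->
  `|(count (fun n => a < u n < b) s)%:R - (b - a) * N%:R| <= D.
Proof.
move=> a0 ab b1; apply: ub_le_sup; last by exists (a, b); rewrite //= a0 ab.
exists (N%:R + N%:R) => _ [[c d] /= [/andP[c0 cd] d1] <-].
apply: (le_trans (ler_normB _ _)); apply: lerD.
  rewrite ger0_norm // ler_nat (leq_trans (count_size _ _)) //.
  by rewrite size_iota subn1.
rewrite ger0_norm ?mulr_ge0 ?subr_ge0 ?(ltW cd) // ler_piMl //; lra.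
Qed.

Lemma discrepancy_ge0 : 0 <= D.
Proof. by apply: le_trans (@discrepancy_ge 0 1 _ _ _). Qed.

(** Open intervals miss the points equal to 0. Their number is [N] minus the count in [(0, 1)],
    which is itself a discrepancy term; hence the factor 2. *)
Lemma count_lt_discrepancy b : 0 <= b <= 1 ->
  `|(count (fun n => u n < b) s)%:R - b * N%:R| <= 2 * D.
Proof.
move=> /andP[]; rewrite le_eqVlt => /predU1P[<- _|b0 b1].
  rewrite mul0r (eq_count (a2 := pred0)) ?count_pred0 ?subrr ?normr0.
    by rewrite mulr_ge0 ?discrepancy_ge0.
  by move=> n /=; apply/negbTE; rewrite -leNgt; case/andP: (u01 n).
have E : (count (fun n => u n < b) s)%:R - b * N%:R =
   ((count (fun n => 0 < u n < b) s)%:R - (b - 0) * N%:R) -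
   ((count (fun n => 0 < u n < 1) s)%:R - (1 - 0) * N%:R).
  have sN : \sum_(n <- s) 1 = N%:R :> R.
    by rewrite sumr_const_iota mul1r.
  have h : (count (fun n => u n < b) s)%:R + (count (fun n => 0 < u n < 1) s)%:R
    = (count (fun n => 0 < u n < b) s)%:R + N%:R :> R.
    rewrite !natr_count -sN -!big_split /=; apply: eq_bigr => n _.
    have /andP[u0 u1] := u01 n; rewrite u1 andbT.
    move: u0; rewrite le_eqVlt => /predU1P[<-|->]; last by rewrite addrC.
    by rewrite b0 ltxx /= addr0 add0r.
  by move: h; set a1 := (count _ _)%:R; set a2 := (count _ _)%:R; set a3 := (count _ _)%:R => h; lra.
rewrite E (_ : 2 * D = D + D); last by ring.
apply: (le_trans (ler_normB _ _)).
by apply: lerD; exact: discrepancy_ge.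
Qed.

(** Discrete Koksma inequality: [f (u n)] is replaced by the value at the left end of its cell, at a
    cost of [L / M] per point, and the rest is summed by parts against the counting error [E]. The
    vanishing grid sum stands for a vanishing integral and removes the expected counts. *)
Lemma koksma_grid f L (M : nat) : (0 < M)%N ->
  (forall x y, `|f x - f y| <= L * `|x - y|) ->
  \sum_(j < M) f (j%:R / M%:R) = 0 ->
  `|\sum_(n <- s) f (u n)| <= L * (2 * D) + L * N%:R / M%:R.
Proof.
move=> M0 fL fM.
have M0' : 0 < M%:R :> R by rewrite ltr0n.
have L0 : 0 <= L.
  by have := fL 1 0; rewrite subr0 normr1 mulr1; apply: le_trans.
pose A (j : nat) : R := (count (fun n => u n < j%:R / M%:R) s)%:R.
pose E j := A j - j%:R / M%:R * N%:R.
have u0 n : 0 <= u n by case/andP: (u01 n).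
have u1 n : u n < 1 by case/andP: (u01 n).
have A0 : A 0%N = 0.
  rewrite /A mul0r (eq_count (a2 := pred0)) ?count_pred0 // => n /=.
  by apply/negbTE; rewrite -leNgt.
have AM : A M = N%:R.
  rewrite /A divff ?gt_eqF // (eq_count (a2 := predT)) => [|n /=].
    by rewrite count_predT size_iota subn1.
  by rewrite u1.
have E0 : E 0%N = 0 by rewrite /E A0 !mul0r subrr.
have EM : E M = 0 by rewrite /E AM divff ?gt_eqF // mul1r subrr.
have EL j : (j <= M)%N -> `|E j| <= 2 * D.
  move=> jM; apply: count_lt_discrepancy.
  by rewrite divr_ge0 //= ler_pdivrMr // mul1r ler_nat.
(* Indicator of [u n] lying in the cell [[j / M, (j + 1) / M)], written as a difference so that it
   telescopes. *)
pose c n (j : nat) : R := (u n < j.+1%:R / M%:R)%R%:R - (u n < j%:R / M%:R)%R%:R.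
have c0 n j : 0 <= c n j.
  rewrite /c subr_ge0 ler_nat; case: (ltP (u n) (j%:R / M%:R)) => // h.
  rewrite (lt_le_trans h) // ler_pM2r ?invr_gt0 // ler_nat //.
have sc n : \sum_(j < M) c n j = 1.
  rewrite -(big_mkord xpredT) /c telescope_sumr // divff ?gt_eqF // u1.
  by rewrite mul0r ltNge u0 subr0.
have S1 : \sum_(n <- s) \sum_(j < M) f (j%:R / M%:R) * c n j =
   \sum_(j < M) f (j%:R / M%:R) * (E j.+1 - E j).
  rewrite exchange_big /=.
  transitivity (\sum_(j < M) f (j%:R / M%:R) * (A j.+1 - A j)).
    by apply: eq_bigr => j _; rewrite -mulr_sumr /A !natr_count sumrB.
  transitivity (\sum_(j < M) f (j%:R / M%:R) * (E j.+1 - E j) +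
     (\sum_(j < M) f (j%:R / M%:R)) * (N%:R / M%:R)).
    rewrite mulr_suml -big_split /=; apply: eq_bigr => j _.
    by rewrite /E -[j.+1%:R]natr1; ring.
  by rewrite fM mul0r addr0.
(* [E] vanishes at both ends, so the summation by parts has no boundary term. *)
have S2 : `|\sum_(j < M) f (j%:R / M%:R) * (E j.+1 - E j)| <= L * (2 * D).
  rewrite (sumr_abel (fun j => f (j%:R / M%:R)) E) E0 EM !mulr0 subrr sub0r.
  rewrite normrN; apply: (le_trans (ler_norm_sum _ _ _)).
  apply: (@le_trans _ _ (\sum_(j < M) (2 * D) * (L / M%:R))).
    apply: ler_sum => j _; rewrite normrM; apply: ler_pM => //.
      by apply: EL.
    apply: (le_trans (fL _ _)).
    rewrite -mulrBl -[j.+1%:R]natr1 addrAC subrr add0r mul1r.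
    by rewrite ger0_norm ?invr_ge0 ?ler0n.
  rewrite sumr_const card_ord -[_ *+ M]mulr_natr.
  rewrite [X in X <= _](_ : _ = L * (2 * D)) //.
  by field; rewrite gt_eqF.
have S3 : `|\sum_(n <- s) f (u n) -
   \sum_(n <- s) \sum_(j < M) f (j%:R / M%:R) * c n j| <= L * N%:R / M%:R.
  rewrite -sumrB; apply: (le_trans (ler_norm_sum _ _ _)).
  apply: (@le_trans _ _ (\sum_(n <- s) L / M%:R)); last first.
    by rewrite sumr_const_iota mulrAC.
  apply: ler_sum => n _.
  have -> : f (u n) = \sum_(j < M) f (u n) * c n j by rewrite -mulr_sumr sc mulr1.
  rewrite -sumrB.
  apply: (le_trans (ler_norm_sum _ _ _)).
  apply: (@le_trans _ _ (\sum_(j < M) L / M%:R * c n j)); last first.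
    by rewrite -mulr_sumr sc mulr1.
  apply: ler_sum => j _.
  rewrite -mulrBl normrM (ger0_norm (c0 n j)).
  rewrite /c; case: ltP => h1; case: ltP => h2; rewrite ?subrr ?mulr0 //.
    rewrite subr0 !mulr1; apply: (le_trans (fL _ _)); apply: ler_wpM2l => //.
    rewrite ger0_norm ?subr_ge0 // lerBlDl; apply: (le_trans (ltW h1)).
    by rewrite -[j.+1%:R]natr1 mulrDl mul1r.
  exfalso; have := le_lt_trans h1 h2.
  by rewrite ltr_pM2r ?invr_gt0 // ltr_nat ltnNge leqnSn.
have := ler_normD (\sum_(n <- s) f (u n) -
   \sum_(n <- s) \sum_(j < M) f (j%:R / M%:R) * c n j)
   (\sum_(n <- s) \sum_(j < M) f (j%:R / M%:R) * c n j).
rewrite subrK => /le_trans; apply.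
by rewrite addrC S1; apply: lerD => //; rewrite -S1.
Qed.

(* Antiperiodicity makes the sum of [f] over an even equidistant grid vanish. *)
Lemma koksma_antiperiodic f L :
  (forall x y, `|f x - f y| <= L * `|x - y|) ->
  (forall x, f (x + 2^-1) = - f x) ->
  `|\sum_(n <- s) f (u n)| <= 2 * L * D.
Proof.
move=> fL fN; apply/ler_addgt0Pr => eps eps0.
have L0 : 0 <= L.
  by have := fL 1 0; rewrite subr0 normr1 mulr1; apply: le_trans.
pose h := (Num.truncn (L * N%:R / eps)).+1.
have hh : L * N%:R / eps < h%:R by exact: truncnS_gt.
have h0 : 0 < h%:R :> R by rewrite ltr0n.
have M0 : (0 < h + h)%N by rewrite addn_gt0.
have := koksma_grid M0 fL; rewrite big_split_ord /=.
have -> : \sum_(j < h) f (j%:R / (h + h)%:R) +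
  \sum_(j < h) f ((h + j)%:R / (h + h)%:R) = 0.
  rewrite -big_split big1 //= => j _.
  have -> : (h + j)%:R / (h + h)%:R = j%:R / (h + h)%:R + 2^-1 :> R.
    by rewrite !natrD; field; rewrite -natrD gt_eqF //= ltr0n.
  by rewrite fN subrr.
move=> /(_ erefl) /le_trans; apply.
rewrite mulrA [L * 2]mulrC lerD2l.
rewrite natrD ler_pdivrMr; last lra.
by move: hh; rewrite ltr_pdivrMr // => hh; nra.
Qed.

End Discrepancy.

Lemma pi_lt4 : (pi : R) <= 4.
Proof. by have := @pihalf_lt2 R; lra. Qed.

Lemma cosDnpi2 n x : cos (x + n%:R * (2 * pi)) = cos x.
Proof. by rewrite !mulr_natl (periodicn (@cosD2pi R)). Qed.

Lemma sinDnpi2 n x : sin (x + n%:R * (2 * pi)) = sin x.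
Proof. by rewrite !mulr_natl (periodicn (@sinD2pi R)). Qed.

Lemma cosDzpi2 (z : int) x : cos (x + z%:~R * (2 * pi)) = cos x.
Proof.
case: z => n; first exact: cosDnpi2.
rewrite NegzE mulrNz mulNr -[LHS](cosDnpi2 n.+1); congr cos.
by rewrite -pmulrn subrK.
Qed.

Lemma sinDzpi2 (z : int) x : sin (x + z%:~R * (2 * pi)) = sin x.
Proof.
case: z => n; first exact: sinDnpi2.
rewrite NegzE mulrNz mulNr -[LHS](sinDnpi2 n.+1); congr sin.
by rewrite -pmulrn subrK.
Qed.

Lemma fracpart_ge0_lt1 x : 0 <= fracpart x < 1.
Proof.
rewrite /fracpart subr_ge0 floor_le ltrBlDl.
by have := floorD1_gt x; rewrite intrD addrC.
Qed.

Lemma cos_fracpart x : cos (2 * pi * fracpart x) = cos (2 * pi * x).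
Proof.
rewrite /fracpart -[LHS](cosDzpi2 (Num.floor x)); congr cos; ring.
Qed.

Lemma sin_fracpart x : sin (2 * pi * fracpart x) = sin (2 * pi * x).
Proof.
rewrite /fracpart -[LHS](sinDzpi2 (Num.floor x)); congr sin; ring.
Qed.

(** The constant 16 is [2 L] for the Lipschitz constant [L = 2 pi], which is at most 8. *)
Lemma cos_sum_le_discrepancy (v : R^nat) N :
  `|\sum_(1 <= n < N.+1) cos (2 * pi * v n)|
    <= 16 * discrepancy (fun n => fracpart (v n)) N.
Proof.
have pi0 := @pi_ge0 R; have pi4 := pi_lt4.
set D := discrepancy _ _.
have D0 : 0 <= D by apply: discrepancy_ge0 => n; exact: fracpart_ge0_lt1.
apply: (@le_trans _ _ (2 * (2 * pi) * D)); last by nra.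
under eq_bigr do rewrite -cos_fracpart.
apply: (@koksma_antiperiodic _ N _ (fun y => cos (2 * pi * y))).
- by move=> n; exact: fracpart_ge0_lt1.
- move=> x y; apply: (le_trans (cos_lipschitz _ _)).
  by rewrite -mulrBr normrM ger0_norm // mulr_ge0.
- move=> x; rewrite (_ : 2 * pi * (x + 2^-1) = 2 * pi * x + pi); last by field.
  by rewrite cosDpi.
Qed.

Lemma sin_sum_le_discrepancy (v : R^nat) N :
  `|\sum_(1 <= n < N.+1) sin (2 * pi * v n)|
    <= 16 * discrepancy (fun n => fracpart (v n)) N.
Proof.
have pi0 := @pi_ge0 R; have pi4 := pi_lt4.
set D := discrepancy _ _.
have D0 : 0 <= D by apply: discrepancy_ge0 => n; exact: fracpart_ge0_lt1.
apply: (@le_trans _ _ (2 * (2 * pi) * D)); last by nra.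
under eq_bigr do rewrite -sin_fracpart.
apply: (@koksma_antiperiodic _ N _ (fun y => sin (2 * pi * y))).
- by move=> n; exact: fracpart_ge0_lt1.
- move=> x y; apply: (le_trans (sin_lipschitz _ _)).
  by rewrite -mulrBr normrM ger0_norm // mulr_ge0.
- move=> x; rewrite (_ : 2 * pi * (x + 2^-1) = 2 * pi * x + pi); last by field.
  by rewrite sinDpi.
Qed.

End Koksma.

(** * Second moments and Gauss sums *)

Section Moments.
Context {R : realType}.
Implicit Types (s : seq nat) (th : nat -> R) (F : nat -> nat).

Lemma sum_cos_sqr_sum_sin_sqr s th :
  (\sum_(i <- s) cos (th i)) ^+ 2 + (\sum_(i <- s) sin (th i)) ^+ 2 =
  \sum_(i <- s) \sum_(j <- s) cos (th i - th j).
Proof.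
rewrite !expr2 !mulr_suml -big_split /=; apply: eq_bigr => i _.
rewrite !mulr_sumr -big_split /=; apply: eq_bigr => j _.
by rewrite cosB.
Qed.

Lemma sum_cos_orthogonal q z : (0 < q)%N ->
  \sum_(a < q) cos (2 * pi * (a%:R / q%:R * z%:R)) =
  (if (q %| z)%N then q%:R else 0) :> R.
Proof.
move=> q0; have q0' : 0 < q%:R :> R by rewrite ltr0n.
have pi0 := @pi_gt0 R.
set r := (z %% q)%N.
have E (a : nat) : cos (2 * pi * (a%:R / q%:R * z%:R)) =
    cos (2 * pi * (a%:R / q%:R * r%:R)) :> R.
  rewrite {1}(divn_eq z q) -/r -[RHS](cosDnpi2 (a * (z %/ q))); congr cos.
  by rewrite natrD !natrM; field; rewrite gt_eqF.
under eq_bigr do rewrite E.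
rewrite /dvdn -/r; case: eqP => [->|/eqP r0].
  under eq_bigr do rewrite !mulr0 cos0.
  by rewrite sumr_const card_ord.
have rq : (r < q)%N by rewrite ltn_pmod.
rewrite -lt0n in r0.
have r0' : 0 < r%:R :> R by rewrite ltr0n.
have rq' : r%:R < q%:R :> R by rewrite ltr_nat.
(* Multiplication by [sin x] makes the sum telescope, as [2 sin x cos (2 a x) = sin ((2a + 1) x) -
   sin ((2a - 1) x)]. The end terms cancel because [2 q x] is a multiple of [2 pi]. *)
pose x : R := pi * (r%:R / q%:R).
have sx : sin x != 0.
  rewrite gt_eqF // sin_gt0_pi // /x mulr_gt0 ?divr_gt0 //=.
  by rewrite gtr_pMr // ltr_pdivrMr // mul1r.
apply: (mulfI sx); rewrite mulr0 mulr_sumr.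
pose f (a : nat) : R := sin ((2 * a%:R - 1) * x) / 2.
rewrite (eq_bigr (fun a : 'I_q => f a.+1 - f a)) => [|a _].
  rewrite -(big_mkord xpredT (fun a => f a.+1 - f a)) telescope_sumr // /f.
  rewrite mulr0 sub0r mulN1r sinN mulNr opprK -mulrDl.
  have -> : (2 * q%:R - 1) * x = - x + r%:R * (2 * pi).
    by rewrite /x; field; rewrite gt_eqF.
  by rewrite sinDnpi2 sinN addNr mul0r.
rewrite /f (_ : 2 * pi * (a%:R / q%:R * r%:R) = 2 * a%:R * x); last first.
  by rewrite /x; field; rewrite gt_eqF.
rewrite (_ : (2 * a.+1%:R - 1) * x = 2 * a%:R * x + x); last first.
  by rewrite -natr1; ring.
rewrite (_ : (2 * a%:R - 1) * x = 2 * a%:R * x - x); last by ring.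
by rewrite sinD sinB; field.
Qed.

Lemma sum_cos_sub_orthogonal q I J : (0 < q)%N ->
  \sum_(a < q) cos (2 * pi * (a%:R / q%:R * I%:R) - 2 * pi * (a%:R / q%:R * J%:R))
  = (if (I == J %[mod q])%N then q%:R else 0) :> R.
Proof.
move=> q0; wlog IJ : I J / (J <= I)%N.
  move=> H; case: (leqP J I) => [|/ltnW] /H // IJ.
  by rewrite eq_sym -IJ; apply: eq_bigr => a _; rewrite -cosN opprB.
rewrite eqn_mod_dvd // -sum_cos_orthogonal //; apply: eq_bigr => a _.
by rewrite -!mulrBr -natrB.
Qed.

(** Parseval: after opening the squares, orthogonality in [a] keeps exactly the pairs with congruent
    values of [F], each with weight [q]. *)
Lemma sum_exp_sum_sqr q s F : (0 < q)%N ->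
  \sum_(a < q) ((\sum_(i <- s) cos (2 * pi * (a%:R / q%:R * (F i)%:R))) ^+ 2 +
                (\sum_(i <- s) sin (2 * pi * (a%:R / q%:R * (F i)%:R))) ^+ 2)
  = q%:R * (\sum_(i <- s) \sum_(j <- s) (F i == F j %[mod q]))%N%:R :> R.
Proof.
move=> q0; pose th (a : nat) i : R := 2 * pi * (a%:R / q%:R * (F i)%:R).
rewrite (eq_bigr (fun a : 'I_q => \sum_(i <- s) \sum_(j <- s)
  cos (th a i - th a j))) => [|a _]; last exact: sum_cos_sqr_sum_sin_sqr.
rewrite /th.
rewrite exchange_big natr_sum mulr_sumr /=; apply: eq_bigr => i _.
rewrite exchange_big natr_sum mulr_sumr /=; apply: eq_bigr => j _.
by rewrite sum_cos_sub_orthogonal //; case: eqP; rewrite ?mulr1 ?mulr0.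
Qed.

Section Gauss.
Variables (p : nat) (pp : prime p).
Let p0 : 0 < p%:R :> R. Proof. by rewrite ltr0n prime_gt0. Qed.

Let c (v : 'F_p) : R := cos (2 * pi * ((v : nat)%:R / p%:R)).

Let cE (m : nat) : c m%:R = cos (2 * pi * (m%:R / p%:R)).
Proof.
rewrite /c val_Fp_nat // {2}(divn_eq m p) -[LHS](cosDnpi2 (m %/ p)); congr cos.
by rewrite natrD natrM; field; rewrite gt_eqF.
Qed.

Let cB (I J : nat) :
  c (I%:R - J%:R) = cos (2 * pi * (I%:R / p%:R) - 2 * pi * (J%:R / p%:R)).
Proof.
(* A natural number representing [I - J] modulo [p], so that [cE] applies. *)
have -> : I%:R - J%:R = (I + J * p.-1)%N%:R :> 'F_p.
  rewrite -subn1 mulnBr muln1 addnBA ?leq_pmulr ?prime_gt0 //.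
  rewrite natrB; last by rewrite (leq_trans (leq_pmulr J (prime_gt0 pp))) ?leq_addl.
  by rewrite natrD natrM pchar_Fp_0 // mulr0 addr0.
rewrite cE -[RHS](cosDnpi2 J); congr cos.
rewrite natrD natrM -subn1 natrB ?prime_gt0 //; field; rewrite gt_eqF //.
Qed.

Lemma sum_Fp (G : 'F_p -> R) : \sum_(i < p) G i%:R = \sum_(v : 'F_p) G v.
Proof.
have pE : ((Zp_trunc (pdiv p)).+2 = p)%N by rewrite Fp_cast.
rewrite -(big_mkord xpredT (fun i => G i%:R)) -{1}pE big_mkord.
by apply: eq_bigr => v _; rewrite natr_Zp.
Qed.

Lemma sum_Fp_blocks (G : 'F_p -> R) K :
  \sum_(1 <= n < (K * p).+1) G n%:R = K%:R * \sum_(v : 'F_p) G v.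
Proof.
elim: K => [|K IH]; first by rewrite mul0n mul0r big_geq.
rewrite mulSnr (big_cat_nat (n := (K * p).+1)) ?ltnS ?leq_addr //= IH.
rewrite -natr1 mulrDl mul1r; congr (_ + _).
rewrite -addSn -{1}[(K * p).+1]add0n big_addn addKn big_mkord.
(* Blocks start at 1 rather than 0, hence a shift by one in ['F_p]. *)
pose H v := G (v + 1).
rewrite (reindex_inj (addIr (1 : 'F_p))) /= -/(H _).
rewrite -(sum_Fp H); apply: eq_bigr => i _; rewrite /H; congr G.
by rewrite addnS -natr1 natrD natrM pchar_Fp_0 // mulr0 addr0.
Qed.

Lemma sum_Fp_cos : \sum_(v : 'F_p) c v = 0.
Proof.
rewrite -sum_Fp; under eq_bigr do rewrite cE -[_ / _]mulr1.
have /= := @sum_cos_orthogonal p 1 (prime_gt0 pp); rewrite dvdn1.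
by case: eqP (prime_gt1 pp) => [->|_ _ ->].
Qed.

(** With [v = u + w] the difference [v^2 - w^2] becomes [u (u + 2 w)], which for [u != 0] is a
    bijection in [w] (as [p] is odd) and sums to 0. Only [u = 0] remains and contributes [p]; the
    [K] periods give the factor [K^2]. *)
Lemma gauss_sum_sqr a K : odd p -> ~~ (p %| a)%N ->
  (\sum_(1 <= n < (K * p).+1) cos (2 * pi * (a%:R / p%:R * (n ^ 2)%:R))) ^+ 2 +
  (\sum_(1 <= n < (K * p).+1) sin (2 * pi * (a%:R / p%:R * (n ^ 2)%:R))) ^+ 2
  = K%:R ^+ 2 * p%:R :> R.
Proof.
move=> op pa; rewrite sum_cos_sqr_sum_sin_sqr.
have Feq0 m : (m%:R == 0 :> 'F_p) = (p %| m)%N.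
  by rewrite -val_eqE /= val_Fp_nat.
have a0 : a%:R != 0 :> 'F_p by rewrite Feq0.
have two0 : 2%:R != 0 :> 'F_p.
  rewrite Feq0; apply: contraL op => p2.
  by rewrite (_ : p = 2)%N //; apply/eqP; rewrite -dvdn_prime2.
pose G (v w : 'F_p) := c (a%:R * v ^+ 2 - a%:R * w ^+ 2).
transitivity (\sum_(1 <= i < (K * p).+1) \sum_(1 <= j < (K * p).+1) G i%:R j%:R).
  apply: eq_bigr => i _; apply: eq_bigr => j _.
  rewrite /G -!natrX -!natrM cB; congr cos.
  by rewrite !natrM; field; rewrite gt_eqF.
under eq_bigr do rewrite (sum_Fp_blocks (G _)).
rewrite -mulr_sumr (sum_Fp_blocks (fun v => \sum_w G v w)) mulrA -expr2.
congr (_ * _); rewrite exchange_big /=.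
transitivity (\sum_(w : 'F_p) \sum_(u : 'F_p) c (a%:R * u * (u + 2%:R * w))).
  apply: eq_bigr => w _; rewrite (reindex_inj (addIr w)) /=.
  by apply: eq_bigr => u _; rewrite /G; congr c; ring.
rewrite exchange_big (bigD1 0) //= [X in _ + X]big1 ?addr0 => [|u u0].
  under eq_bigr do rewrite mulr0 mul0r /c /= mul0r mulr0 cos0.
  by rewrite sumr_const card_Fp.
rewrite -[RHS]sum_Fp_cos [RHS](reindex_inj (h := fun w => a%:R * u * (u + 2%:R * w))) //.
move=> w w' /(mulfI (mulf_neq0 a0 u0)) /addrI; exact: mulfI.
Qed.

End Gauss.
End Moments.

(** * Perturbation of the frequency *)

Section MajorArc.
Context {R : realType}.

Lemma leq_pow2r m n k : (m <= n)%N -> (m ^ k <= n ^ k)%N.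
Proof. by case: k => // k mn; rewrite leq_exp2r. Qed.

Lemma sumr_by_parts (u v : nat -> R) N :
  \sum_(1 <= n < N.+1) u n * v n =
  (\sum_(1 <= n < N.+1) u n) * v N -
  \sum_(1 <= n < N) (\sum_(1 <= i < n.+1) u i) * (v n.+1 - v n).
Proof.
elim: N => [|N IH]; first by rewrite !big_geq // mul0r subrr.
rewrite big_nat_recr //= IH [X in _ = X * _ - _]big_nat_recr //=.
case: N IH => [|N] IH; first by rewrite !big_geq //; ring.
by rewrite [X in _ = _ - X]big_nat_recr //=; ring.
Qed.

Lemma sumr_by_parts_le (u v w : nat -> R) N : (0 < N)%N ->
  `|v N| <= w N ->
  (forall n, `|v n.+1 - v n| <= w n.+1 - w n) ->
  `|\sum_(1 <= n < N.+1) u n * v n| <=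
  w N * `|\sum_(1 <= n < N.+1) u n| +
  \sum_(1 <= n < N) (w n.+1 - w n) * `|\sum_(1 <= i < n.+1) u i|.
Proof.
move=> N0 vN vn; rewrite sumr_by_parts; apply: (le_trans (ler_normB _ _)).
apply: lerD; first by rewrite normrM mulrC ler_wpM2r.
apply: (le_trans (ler_norm_sum _ _ _)); apply: ler_sum => n _.
by rewrite normrM mulrC ler_wpM2r.
Qed.

Variables (q d : nat).
Hypothesis q0 : (0 < q)%N.

Definition arg_frac (a n : nat) : R := 2 * pi * (a%:R / q%:R * (n ^ d)%:R).
Definition cos_sum a N : R := \sum_(1 <= n < N.+1) cos (arg_frac a n).
Definition sin_sum a N : R := \sum_(1 <= n < N.+1) sin (arg_frac a n).
(** Squared modulus of the Weyl sum of [exp (2 pi i a n^d / q)] over [1 <= n <= N]. *)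
Definition energy a N : R := cos_sum a N ^+ 2 + sin_sum a N ^+ 2.

Lemma sum_energy N : \sum_(a < q) energy a N =
  q%:R * (\sum_(1 <= i < N.+1) \sum_(1 <= j < N.+1)
    (i ^ d == j ^ d %[mod q]))%N%:R.
Proof. exact: sum_exp_sum_sqr. Qed.

Variables (N : nat) (rho : R).
Hypotheses (N0 : (0 < N)%N) (rho0 : 0 <= rho).

(** Largest phase shift that the [n]-th term undergoes when [a / q] is moved by at most [rho]. *)
Definition arc_phase (n : nat) : R := 2 * pi * rho * (n ^ d)%:R.
Local Notation w := arc_phase.

Let w_ge0 n : 0 <= w n.
Proof. by rewrite /arc_phase !mulr_ge0 // pi_ge0. Qed.

Let w_mono n : 0 <= w n.+1 - w n.
Proof.
rewrite subr_ge0 /w ler_wpM2l // ?mulr_ge0 ?pi_ge0 // ler_nat.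
exact: leq_pow2r.
Qed.

(** The weights of a summation by parts, applied to energies instead of moduli: being linear in the
    energies, its mean over [a] follows from the second moment. [dev] is the same expression with
    moduli. *)
Definition arc_cost a := w N * energy a N +
  \sum_(1 <= n < N) (w n.+1 - w n) * energy a n.

Let dev a := w N * (`|cos_sum a N| + `|sin_sum a N|) +
  \sum_(1 <= n < N) (w n.+1 - w n) * (`|cos_sum a n| + `|sin_sum a n|).

(** The inequality [|t| <= g / 2 + t^2 / (2 g)], at the size [g] of the main term, passes from
    moduli to energies; the weights telescope to at most [2 w N]. *)
Let dev_le a g : 0 < g -> dev a <= 2 * w N * g + arc_cost a / (2 * g).
Proof.
move=> g0.
have amgm (t : R) : `|t| <= g / 2 + t ^+ 2 / (2 * g).
  rewrite -(real_normK (num_real t)) -subr_ge0.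
  have -> : g / 2 + `|t| ^+ 2 / (2 * g) - `|t| = (`|t| - g) ^+ 2 / (2 * g).
    by field; rewrite gt_eqF.
  by rewrite divr_ge0 ?sqr_ge0 // mulr_ge0 // ltW.
have amgm2 n : `|cos_sum a n| + `|sin_sum a n| <= g + energy a n / (2 * g).
  by have := lerD (amgm (cos_sum a n)) (amgm (sin_sum a n)); rewrite /energy; lra.
apply: (@le_trans _ _ (w N * (g + energy a N / (2 * g)) +
  \sum_(1 <= n < N) (w n.+1 - w n) * (g + energy a n / (2 * g)))).
  by apply: lerD; [|apply: ler_sum => n _]; apply: ler_wpM2l.
have -> : \sum_(1 <= n < N) (w n.+1 - w n) * (g + energy a n / (2 * g)) =
  (w N - w 1%N) * g + (\sum_(1 <= n < N) (w n.+1 - w n) * energy a n) / (2 * g).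
  rewrite -telescope_sumr // !mulr_suml -big_split /=.
  by apply: eq_bigr => n _; ring.
rewrite /arc_cost; have := mulr_ge0 (w_ge0 1) (ltW g0); lra.
Qed.

(** The change of the exponential sum comes from multiplying its terms by
    [exp (2 pi i beta n^d) - 1]: its real part is [C - S'], its imaginary part [S + C']. Each of the
    four sums is summed by parts, the increments of the factor being bounded by those of the
    phase. *)
Let perturbation_le beta a : `|beta| <= rho ->
  let C := \sum_(1 <= n < N.+1) cos (arg_frac a n) * (cos (2 * pi * beta * (n ^ d)%:R) - 1) in
  let S := \sum_(1 <= n < N.+1) sin (arg_frac a n) * (cos (2 * pi * beta * (n ^ d)%:R) - 1) in
  let C' := \sum_(1 <= n < N.+1) cos (arg_frac a n) * sin (2 * pi * beta * (n ^ d)%:R) in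
  let S' := \sum_(1 <= n < N.+1) sin (arg_frac a n) * sin (2 * pi * beta * (n ^ d)%:R) in
  `|C| + `|S'| <= dev a /\ `|S| + `|C'| <= dev a.
Proof.
move=> hb C S C' S'.
pose B n := 2 * pi * beta * (n ^ d)%:R.
have pi0 := @pi_ge0 R.
have nB (m : R) : 0 <= m -> `|2 * pi * beta * m| <= 2 * pi * rho * m.
  move=> m0; rewrite normrM (ger0_norm m0) ler_wpM2r // normrM ger0_norm.
    by rewrite ler_wpM2l // mulr_ge0.
  by rewrite mulr_ge0.
have Bw n : `|B n| <= w n by exact: nB.
have dB n : `|B n.+1 - B n| <= w n.+1 - w n.
  have -> : w n.+1 - w n = 2 * pi * rho * ((n.+1 ^ d)%:R - (n ^ d)%:R) by rewrite /arc_phase; ring.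
  by rewrite -mulrBr; apply: nB; rewrite subr_ge0 ler_nat leq_pow2r.
have sp (u : nat -> R) (f : R -> R) : (forall x y, `|f x - f y| <= `|x - y|) ->
  f 0 = 0 -> `|\sum_(1 <= n < N.+1) u n * f (B n)| <=
  w N * `|\sum_(1 <= n < N.+1) u n| +
  \sum_(1 <= n < N) (w n.+1 - w n) * `|\sum_(1 <= i < n.+1) u i|.
  move=> fL f0; apply: (@sumr_by_parts_le _ (f \o B)) => //= [|n].
    by have := fL (B N) 0; rewrite f0 !subr0 => /le_trans; apply.
  exact: le_trans (fL _ _) (dB n).
have devE : dev a = 
  (w N * `|cos_sum a N| + \sum_(1 <= n < N) (w n.+1 - w n) * `|cos_sum a n|) +
  (w N * `|sin_sum a N| + \sum_(1 <= n < N) (w n.+1 - w n) * `|sin_sum a n|).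
  rewrite addrACA -big_split /= /dev mulrDr; congr (_ + _).
  by apply: eq_bigr => n _; rewrite mulrDr.
have cL x y : `|(cos x - 1) - (cos y - 1)| <= `|x - y|.
  by rewrite opprB addrA subrK cos_lipschitz.
rewrite devE; split; [|rewrite addrC]; apply: lerD.
- by apply: (sp _ (fun z => cos z - 1)); rewrite ?cos0 ?subrr.
- by apply: (sp _ sin); [exact: sin_lipschitz|rewrite sin0].
- by apply: (sp _ sin); [exact: sin_lipschitz|rewrite sin0].
- by apply: (sp _ (fun z => cos z - 1)); rewrite ?cos0 ?subrr.
Qed.

(** The hypotheses give [dev a <= g / 8 + g / 8]. If the discrepancy were below [g / 64], the cosine
    and sine sums at [x] would be below [g / 4], those at [a / q] below [g / 2], and the energy at
    most [g^2 / 2]. *)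
Lemma major_arc_discrepancy a x g : 0 < g -> `|x - a%:R / q%:R| <= rho ->
  w N <= 16^-1 -> g ^+ 2 <= energy a N -> arc_cost a <= g ^+ 2 / 4 ->
  g / 64 <= monomial_discrepancy d x N.
Proof.
move=> g0 hx wN eN cN; set beta := x - _ in hx.
have [h1 h2] := perturbation_le a hx.
have hdev : dev a <= g / 4.
  apply: (le_trans (dev_le a g0)).
  have : arc_cost a / (2 * g) <= (g ^+ 2 / 4) / (2 * g).
    by rewrite ler_wpM2r // invr_ge0 mulr_ge0 // ltW.
  have -> : (g ^+ 2 / 4) / (2 * g) = g / 8 by field; rewrite gt_eqF.
  have : w N * g <= 16^-1 * g by rewrite ler_wpM2r // ltW.
  lra.
have xn n : 2 * pi * (x * n%:R ^+ d) = arg_frac a n + 2 * pi * beta * (n ^ d)%:R.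
  by rewrite /arg_frac /beta natrX; ring.
have := cos_sum_le_discrepancy (fun n => x * n%:R ^+ d) N.
have := sin_sum_le_discrepancy (fun n => x * n%:R ^+ d) N.
rewrite -/(monomial_discrepancy d x N); set D := monomial_discrepancy _ _ _.
set Sx := \sum_(1 <= n < N.+1) _; set Cx := \sum_(1 <= n < N.+1) _.
move=> hS hC.
move: h1 h2; set C1 := \sum_(1 <= n < N.+1) _; set S1 := \sum_(1 <= n < N.+1) _.
set S2 := \sum_(1 <= n < N.+1) _; set C2 := \sum_(1 <= n < N.+1) _ => h1 h2.
have EC : Cx = cos_sum a N + C1 - S1.
  rewrite /Cx /cos_sum /C1 /S1 -big_split -sumrB /=; apply: eq_bigr => n _.
  by rewrite xn cosD; ring.
have ES : Sx = sin_sum a N + S2 + C2.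
  rewrite /Sx /sin_sum /C2 /S2 -!big_split /=; apply: eq_bigr => n _.
  by rewrite xn sinD; ring.
rewrite leNgt; apply/negP => hD.
have hC' : `|cos_sum a N| < g / 2.
  have -> : cos_sum a N = Cx - (C1 - S1) by rewrite EC; ring.
  apply: (le_lt_trans (ler_normB _ _)); have := ler_normB C1 S1; lra.
have hS' : `|sin_sum a N| < g / 2.
  have -> : sin_sum a N = Sx - (S2 + C2) by rewrite ES; ring.
  apply: (le_lt_trans (ler_normB _ _)); have := ler_normD S2 C2; lra.
have sq (t : R) : `|t| < g / 2 -> t ^+ 2 <= g ^+ 2 / 4.
  move=> /ltW ht; rewrite -(real_normK (num_real t)).
  by have := normr_ge0 t; nra.
have := sq _ hC'; have := sq _ hS'; move: eN; rewrite /energy.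
have : 0 < g ^+ 2 by rewrite exprn_gt0.
lra.
Qed.

Lemma sum_arc_cost_le V : (forall n, (n <= N)%N ->
    (\sum_(1 <= i < n.+1) \sum_(1 <= j < n.+1) (i ^ d == j ^ d %[mod q]))%N%:R
      <= V) ->
  \sum_(a < q) arc_cost a <= 2 * w N * (q%:R * V).
Proof.
move=> hV; rewrite big_split /= -mulr_sumr exchange_big /=.
have sE n : (n <= N)%N -> \sum_(a < q) energy a n <= q%:R * V.
  by move=> nN; rewrite sum_energy ler_wpM2l ?hV.
have V0 : 0 <= q%:R * V.
  apply: le_trans (sE N (leqnn _)); apply: sumr_ge0 => a _.
  by rewrite addr_ge0 ?sqr_ge0.
apply: (@le_trans _ _ (w N * (q%:R * V) +
  \sum_(1 <= n < N) (w n.+1 - w n) * (q%:R * V))).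
  apply: lerD; first by rewrite ler_wpM2l ?sE.
  apply: ler_sum_nat => n /andP[_ nN]; rewrite -mulr_sumr ler_wpM2l //.
  by rewrite sE // ltnW.
rewrite -mulr_suml telescope_sumr //.
by have := mulr_ge0 (w_ge0 1) V0; lra.
Qed.

Lemma count_markov (f : nat -> R) t : 0 < t -> (forall a, 0 <= f a) ->
  (count (fun a => t < f a) (iota 0 q))%:R * t <= \sum_(a < q) f a.
Proof.
move=> t0 f0; rewrite natr_count mulr_suml -(big_mkord xpredT f).
rewrite /index_iota subn0; apply: ler_sum => a _.
by case: ltP => h; rewrite ?mul1r ?mul0r // ltW.
Qed.

(** A numerator is bad if its energy is too small (share [kappa]) or its cost too large. For the
    latter, the mean cost is at most [2 w N V], and Markov's inequality at the threshold [g^2 / 4]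
    gives the share [8 w N V / g^2]. *)
Lemma major_arc_exceptions g V kappa eta : 0 < g -> w N <= 16^-1 ->
  (forall n, (n <= N)%N ->
    (\sum_(1 <= i < n.+1) \sum_(1 <= j < n.+1) (i ^ d == j ^ d %[mod q]))%N%:R
      <= V) ->
  8 * w N * V <= eta * g ^+ 2 ->
  (count (fun a => energy a N < g ^+ 2) (iota 0 q))%:R <= kappa * q%:R ->
  exists bad : pred nat,
    (count bad (iota 0 q))%:R <= (kappa + eta) * q%:R /\
    forall a, ~~ bad a -> forall x, `|x - a%:R / q%:R| <= rho ->
      g / 64 <= monomial_discrepancy d x N.
Proof.
move=> g0 wN hV heta hk.
have g2 : 0 < g ^+ 2 by rewrite exprn_gt0.
exists (fun a => (energy a N < g ^+ 2) || (g ^+ 2 / 4 < arc_cost a)); split.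
  have h1 : (count (fun a => g ^+ 2 / 4 < arc_cost a) (iota 0 q))%:R <= eta * q%:R.
    have c0 a : 0 <= arc_cost a.
      have e0 n : 0 <= energy a n by rewrite addr_ge0 ?sqr_ge0.
      apply: addr_ge0; first exact: mulr_ge0.
      by apply: sumr_ge0 => n _; apply: mulr_ge0.
    have g4 : 0 < g ^+ 2 / 4 by lra.
    have := le_trans (count_markov g4 c0) (sum_arc_cost_le hV).
    have : 8 * w N * V * q%:R <= eta * g ^+ 2 * q%:R by rewrite ler_wpM2r.
    set c := (count _ _)%:R => h2 h3.
    rewrite -(ler_pM2r g4); lra.
  apply: (@le_trans _ _ ((count (fun a => energy a N < g ^+ 2) (iota 0 q))%:R +
     (count (fun a => g ^+ 2 / 4 < arc_cost a) (iota 0 q))%:R)); last by lra.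
  rewrite -natrD ler_nat -count_predUI leq_addr //.
move=> a; rewrite negb_or -!leNgt => /andP[h1 h2] x hx.
exact: major_arc_discrepancy hx _ _ _.
Qed.

End MajorArc.

(** * Exceptional numerators for denominators [p] and [p^d] *)

Section Exceptions.
Context {R : realType}.

Lemma sum_pow_eq_mod_le_real p e d n : prime p -> ~~ (p %| d)%N -> (0 < e)%N ->
  (\sum_(1 <= i < n.+1) \sum_(1 <= j < n.+1)
     (i ^ d == j ^ d %[mod p ^ e]))%N%:R <=
  n%:R * (n%:R / (p ^ e)%:R + 1) * d%:R + (n%:R / p%:R) ^+ 2 :> R.
Proof.
move=> pp pd e0.
have divR m : (0 < m)%N -> (n %/ m)%:R <= n%:R / m%:R :> R.
  by move=> m0; rewrite ler_pdivlMr ?ltr0n // -natrM ler_nat leq_trunc_div.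
have q0 : (0 < p ^ e)%N by rewrite expn_gt0 prime_gt0.
have h := sum_pow_eq_mod_le n pp pd e0; rewrite -(ler_nat R) in h.
apply: (le_trans h); rewrite -mulnn natrD !natrM -[_.+1%:R]natr1 -mulrA.
apply: lerD; last by rewrite expr2 ler_pM ?divR ?prime_gt0.
by rewrite ler_wpM2l // ler_wpM2r // lerD2r divR.
Qed.

(** By the Gauss sum only the numerator 0 can have low energy, which is the condition on [kappa].
    With [g^2 = K^2 p] and at most [V = 5 K^2 p] congruent pairs, the constant 40 is [8 * 5]. *)
Lemma exceptions_prime_square p K (rho kappa eta : R) :
  prime p -> odd p -> (0 < K)%N -> 0 <= rho ->
  arc_phase 2 rho (K * p) <= 16^-1 -> 40 * arc_phase 2 rho (K * p) <= eta ->
  1 <= kappa * p%:R ->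
  exists bad : pred nat,
    (count bad (iota 0 p))%:R <= (kappa + eta) * p%:R /\
    forall a, ~~ bad a -> forall x, `|x - a%:R / p%:R| <= rho ->
      K%:R * Num.sqrt p%:R / 64 <= monomial_discrepancy 2 x (K * p).
Proof.
move=> pp op K0 rho0 w16 weta hk.
have p0 := prime_gt0 pp; have p0' : 0 < p%:R :> R by rewrite ltr0n.
have K1 : 1 <= K%:R :> R by rewrite ler1n.
have p1 : 1 <= p%:R :> R by rewrite ler1n.
have g0 : 0 < K%:R * Num.sqrt p%:R :> R by rewrite mulr_gt0 ?sqrtr_gt0 ?ltr0n.
have g2 : (K%:R * Num.sqrt p%:R) ^+ 2 = K%:R ^+ 2 * p%:R :> R.
  by rewrite exprMn sqr_sqrtr.
have p2 : ~~ (p %| 2)%N.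
  rewrite dvdn_prime2 //; apply: contraL op => /eqP ->; by [].
have wN0 : 0 <= arc_phase 2 rho (K * p) by rewrite !mulr_ge0 ?pi_ge0.
have KpR : (K * p)%:R = K%:R * p%:R :> R by rewrite natrM.
apply: (@major_arc_exceptions _ p 2 p0 (K * p) rho _ rho0 _
   (5 * (K%:R ^+ 2 * p%:R))); rewrite ?muln_gt0 ?K0 //.
- move=> n nN; have := @sum_pow_eq_mod_le_real p 1 2 n pp p2 isT.
  rewrite expn1 => /le_trans; apply.
  have nN' : n%:R <= K%:R * p%:R :> R by rewrite -KpR ler_nat.
  have np : n%:R / p%:R <= K%:R :> R by rewrite ler_pdivrMr.
  have np0 : 0 <= n%:R / p%:R :> R by rewrite divr_ge0.
  have h1 : n%:R * (n%:R / p%:R + 1) <= (K%:R * p%:R) * (K%:R + 1) :> R.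
    by apply: ler_pM => //; lra.
  have h2 : (n%:R / p%:R) ^+ 2 <= K%:R ^+ 2 :> R by rewrite ler_pXn2r ?nnegrE.
  have h3 : K%:R * p%:R <= K%:R * p%:R * K%:R :> R.
    by rewrite ler_peMr // mulr_ge0.
  have h4 : K%:R ^+ 2 <= K%:R ^+ 2 * p%:R :> R by rewrite ler_peMr // sqr_ge0.
  by move: h1 h2 h3 h4; rewrite !expr2; lra.
- rewrite g2; have : 0 <= K%:R ^+ 2 * p%:R :> R by rewrite mulr_ge0 ?sqr_ge0.
  by move: weta; set A := K%:R ^+ 2 * p%:R; set B := arc_phase _ _ _; nra.
- apply: le_trans hk; rewrite lern1.
  rewrite -size_filter -[X in (_ <= X)%N](size_iota 0 1).
  apply: uniq_leq_size; first by rewrite filter_uniq ?iota_uniq.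
  move=> a; rewrite mem_filter mem_iota add0n => /andP[h /andP[_ ap]].
  have [a0|a0] := posnP a; first by rewrite a0.
  move: h; rewrite /energy /cos_sum /sin_sum /arg_frac gauss_sum_sqr // ?g2 ?ltxx //.
  by rewrite gtnNdvd.
Qed.

(** The multiples of [p] contribute exactly [K] to the cosine sum. The other terms have mean square
    at most [d K^2 (1 / p + p / K)] over the numerators, and low energy forces their square to
    exceed [K^2 / 4]; Markov's inequality gives the factor [4 d]. With [g = K / 2] and
    [V = (2 d + 1) K^2], the constant 32 is [8 * 4]. *)
Lemma exceptions_prime_power p d K (rho eta : R) :
  prime p -> (2 < d)%N -> ~~ (p %| d)%N -> (p <= K)%N -> 0 <= rho ->
  arc_phase d rho (K * p) <= 16^-1 ->
  32 * (2 * d%:R + 1) * arc_phase d rho (K * p) <= eta ->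
  exists bad : pred nat,
    (count bad (iota 0 (p ^ d)))%:R <=
      (4 * d%:R * (p%:R^-1 + p%:R / K%:R) + eta) * (p ^ d)%:R /\
    forall a, ~~ bad a -> forall x, `|x - a%:R / (p ^ d)%:R| <= rho ->
      K%:R / 2 / 64 <= monomial_discrepancy d x (K * p).
Proof.
move=> pp d2 pd pK rho0 w16 weta.
have d0 : (0 < d)%N by lia.
have p0 := prime_gt0 pp; have p0' : 0 < p%:R :> R by rewrite ltr0n.
have q0 : (0 < p ^ d)%N by rewrite expn_gt0 p0.
have q0' : 0 < (p ^ d)%:R :> R by rewrite ltr0n.
have K0 : (0 < K)%N by lia.
have K1 : 1 <= K%:R :> R by rewrite ler1n.
have p1 : 1 <= p%:R :> R by rewrite ler1n.
have pK' : p%:R <= K%:R :> R by rewrite ler_nat.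
have g0 : 0 < K%:R / 2 :> R by lra.
have wN0 : 0 <= arc_phase d rho (K * p) by rewrite !mulr_ge0 ?pi_ge0.
have KpR : (K * p)%:R = K%:R * p%:R :> R by rewrite natrM.
have qp3 : p%:R ^+ 3 <= (p ^ d)%:R :> R by rewrite -natrX ler_nat leq_pexp2l.
have Nq : (K * p)%:R / (p ^ d)%:R <= K%:R / p%:R ^+ 2 :> R.
  rewrite ler_pdivrMr // KpR -mulrA ler_wpM2l //.
  by rewrite ler_pdivlMl ?exprn_gt0 // -exprSr.
have d1 : 1 <= d%:R :> R by rewrite ler1n.
(* Pairs with first member prime to [p]. Here [d >= 3] enters: the quotient [N / p^d] is at most
   [K / p^2]. *)
have unitsum n : (n <= K * p)%N ->
   n%:R * (n%:R / (p ^ d)%:R + 1) * d%:R <= K%:R ^+ 2 * d%:R * (p%:R^-1 + p%:R / K%:R) :> R.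
  move=> nN; have nN' : n%:R <= (K * p)%:R :> R by rewrite ler_nat.
  have h1 : n%:R / (p ^ d)%:R <= K%:R / p%:R ^+ 2 :> R.
    by apply: le_trans Nq; rewrite ler_wpM2r // invr_ge0 ltW.
  have : n%:R * (n%:R / (p ^ d)%:R + 1) <= (K%:R * p%:R) * (K%:R / p%:R ^+ 2 + 1) :> R.
    by apply: ler_pM; rewrite ?addr_ge0 ?divr_ge0 -?KpR ?lerD2r.
  move=> /(ler_wpM2r (ler0n R d)) /le_trans; apply.
  rewrite [X in X <= _](_ : _ = K%:R ^+ 2 * d%:R * (p%:R^-1 + p%:R / K%:R)) //.
  by field; rewrite !gt_eqF // ltr0n.
apply: (@major_arc_exceptions _ (p ^ d) d q0 (K * p) rho _ rho0 _
   ((2 * d%:R + 1) * K%:R ^+ 2)); rewrite ?muln_gt0 ?K0 //.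
- move=> n nN; apply: le_trans (sum_pow_eq_mod_le_real n pp pd d0) _.
  have h1 : p%:R^-1 + p%:R / K%:R <= 2 :> R.
    have : p%:R^-1 <= 1 :> R by rewrite invf_le1.
    have : p%:R / K%:R <= 1 :> R by rewrite ler_pdivrMr ?mul1r // ltr0n.
    lra.
  have h2 := unitsum n nN.
  have h3 : K%:R ^+ 2 * d%:R * (p%:R^-1 + p%:R / K%:R) <= K%:R ^+ 2 * d%:R * 2 :> R.
    by rewrite ler_wpM2l // mulr_ge0 ?sqr_ge0.
  have h4 : (n%:R / p%:R) ^+ 2 <= K%:R ^+ 2 :> R.
    by rewrite ler_pXn2r ?nnegrE ?divr_ge0 // ler_pdivrMr // -KpR ler_nat.
  lra.
- have : 0 <= K%:R ^+ 2 :> R by rewrite sqr_ge0.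
  rewrite exprMn; move: weta; set A := K%:R ^+ 2; set B := arc_phase _ _ _.
  by move=> h A0; have := ler_wpM2r A0 h; lra.
- pose s := [seq n <- index_iota 1 (K * p).+1 | ~~ (p %| n)%N].
  pose T a : R := \sum_(n <- s) cos (arg_frac (p ^ d) d a n).
  pose T' a : R := \sum_(n <- s) sin (arg_frac (p ^ d) d a n).
  have CE a : cos_sum (p ^ d) d a (K * p) = K%:R + T a.
    rewrite /cos_sum (bigID (fun n => (p %| n)%N)) /= /T big_filter; congr (_ + _).
    rewrite (eq_bigr (fun=> 1)) => [|n /dvdnP[m ->]].
      rewrite big_const_seq iter_addr_0; congr (_%:R).
      by rewrite -[RHS](mulnK K p0) -count_dvdn.
    rewrite /arg_frac -[RHS](@cos0 R) -[RHS](cosDnpi2 (a * m ^ d)) add0r; congr cos.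
    by rewrite expnMn !natrM; field; rewrite gt_eqF.
  have sub : forall a, energy (p ^ d) d a (K * p) < (K%:R / 2 : R) ^+ 2 ->
     K%:R ^+ 2 / 4 < T a ^+ 2 + T' a ^+ 2.
    move=> a; rewrite /energy CE => h.
    have := sqr_ge0 (sin_sum (p ^ d) d a (K * p)); have := sqr_ge0 (T' a).
    by move: h; rewrite !expr2; nra.
  have K4 : 0 < K%:R ^+ 2 / 4 :> R by rewrite divr_gt0 // exprn_gt0 // ltr0n.
  have T0 a : 0 <= T a ^+ 2 + T' a ^+ 2 by rewrite addr_ge0 ?sqr_ge0.
  have h1 := @count_markov R (p ^ d) _ _ K4 T0.
  have h2 : \sum_(a < p ^ d) (T a ^+ 2 + T' a ^+ 2) <=
     (p ^ d)%:R * (K%:R ^+ 2 * d%:R * (p%:R^-1 + p%:R / K%:R)).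
    rewrite (sum_exp_sum_sqr s (fun n => n ^ d)%N q0) ler_wpM2l //.
    apply: le_trans (unitsum (K * p)%N (leqnn _)).
    rewrite -mulrA natr_sum.
    apply: (@le_trans _ _ (\sum_(1 <= i < (K * p).+1)
       ((K * p)%:R / (p ^ d)%:R + 1) * d%:R)); last first.
      by rewrite sumr_const_iota mulrC.
    rewrite big_filter big_mkcond /=; apply: ler_sum => i _; case: ifP => pi.
      apply: (@le_trans _ _ (((K * p) %/ p ^ d).+1 * d)%:R).
        rewrite ler_nat big_filter; apply: leq_trans (count_pow_eq_mod_le (K * p) pp pd pi d0).
        rewrite -sum_nat_count big_mkcond leq_sum // => j _; by case: ifP.
      rewrite natrM ler_wpM2r // -[_.+1%:R]natr1 lerD2r.
      by rewrite ler_pdivlMr // -natrM ler_nat leq_trunc_div.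
    by rewrite mulr_ge0 // addr_ge0 // divr_ge0.
  have h3 : (count (fun a => energy (p ^ d) d a (K * p) < (K%:R / 2 : R) ^+ 2) (iota 0 (p ^ d)))%:R <=
    (count (fun a => (K%:R ^+ 2 / 4 : R) < T a ^+ 2 + T' a ^+ 2) (iota 0 (p ^ d)))%:R :> R.
    by rewrite ler_nat; apply: sub_count => a; exact: sub.
  apply: (le_trans h3); rewrite -(ler_pM2r K4); apply: (le_trans h1).
  apply: (le_trans h2).
  rewrite [X in X <= _](_ : _ = 4 * d%:R * (p%:R^-1 + p%:R / K%:R) * (p ^ d)%:R * (K%:R ^+ 2 / 4)) //.
  by field; rewrite !gt_eqF // ltr0n.
Qed.

End Exceptions.

(** * Well spaced fractions in an interval *)

Section Fractions.
Context {R : realType}.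

(* The intervals [c - rho, c + rho] are the children of [u, u + l].  The constants
   20 and 4 match the 80 in [light], so that weights average to at most 1/2 in
   [light_child]. *)
Definition branching (s : R) (P : R -> Prop) (u l eps : R) : Prop :=
  exists (cs : seq R) (rho delta : R),
  [/\ [/\ 0 < rho, 2 * rho <= delta & delta <= eps],
      (0 < size cs)%N,
      (forall c, c \in cs -> u + rho <= c <= u + l - rho),
      (forall c x, c \in cs -> `|x - c| <= rho -> P x) &
      [/\ uniq cs,
          (forall b c, b \in cs -> c \in cs -> b != c -> 2 * delta < `|b - c|),
          (forall c0 t, delta <= t <= l ->
            (count (fun c => `|c - c0| <= 2 * t) cs)%:R <=
              20 * (size cs)%:R * (t / l) `^ s) &
          4 * l `^ s <= (size cs)%:R * (2 * rho) `^ s]].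

(** The integer part of [(f x - A) / delta] is injective on separated points. A negative [L] is
    allowed, for an empty list, because [count_close_fractions] takes [L = H - 1]. *)
Lemma size_separated_le (T : eqType) (f : T -> R) (s : seq T) (delta A L : R) :
  uniq s -> 0 < delta -> - delta <= L ->
  (forall x, x \in s -> A <= f x <= A + L) ->
  (forall x y, x \in s -> y \in s -> x != y -> delta <= `|f x - f y|) ->
  (size s)%:R <= L / delta + 1.
Proof.
move=> us d0 Ld fA fs.
have [->|s0] := eqVneq s [::].
  by rewrite -lerBlDr sub0r ler_pdivlMr // mulN1r.
have [x xs] : exists x, x \in s by case: s s0 {us fA fs} => // x s _; exists x; rewrite mem_head.
have L0 : 0 <= L by have /andP[] := fA x xs; lra.
pose g x := Num.truncn ((f x - A) / delta).
have g0 z : z \in s -> 0 <= (f z - A) / delta.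
  by move=> /fA /andP[h _]; rewrite divr_ge0 ?subr_ge0 // ltW.
have ginj : {in s &, injective g}.
  move=> y z ys zs gyz; apply/eqP; apply: contraT => yz.
  have := fs _ _ ys zs yz.
  have /andP[y1 y2] := truncn_itv (g0 _ ys).
  have /andP[z1 z2] := truncn_itv (g0 _ zs).
  rewrite -/(g y) -/(g z) gyz -natr1 in y1 y2 z1 z2.
  move: y1 y2 z1 z2; rewrite !ler_pdivlMr // !ltr_pdivrMr // => y1 y2 z1 z2.
  rewrite leNgt => /negP; case.
  by rewrite ltr_norml; apply/andP; split; lra.
have : (size s <= (Num.truncn (L / delta)).+1)%N.
  rewrite -(size_map g) -[X in (_ <= X)%N](size_iota 0).
  apply: uniq_leq_size; first by rewrite map_inj_in_uniq.
  move=> _ /mapP[z zs ->]; rewrite mem_iota add0n ltnS /=.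
  apply: le_truncn; rewrite ler_pM2r ?invr_gt0 //.
  by have /andP[_] := fA _ zs; lra.
rewrite -(ler_nat R) -natr1 => /le_trans; apply; rewrite lerD2r.
by rewrite truncn_le divr_ge0 // ltW.
Qed.

Lemma ler1_dist_nat (m n : nat) : m != n -> 1 <= `|m%:R - n%:R| :> R.
Proof.
wlog mn : m n / (m <= n)%N.
  move=> H; case: (leqP m n) => [|/ltnW] h; first exact: H.
  by rewrite eq_sym distrC; apply: H.
move=> mn'; have {mn mn'} mn : (m < n)%N by lia.
by rewrite distrC -natrB ?(ltnW mn) // ger0_norm // ler1n subn_gt0.
Qed.

Definition frac (e : nat) (x : nat * nat) : R := x.2%:R / (x.1 ^ e)%:R.

Lemma count_frac_ge (q : nat) (A B : R) : (0 < q)%N -> 0 <= A -> A <= B -> B < 1 ->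
  q%:R * (B - A) - 1 <= (count (fun a => A <= a%:R / q%:R <= B) (iota 0 q))%:R.
Proof.
move=> q0 A0 AB B1; have q0' : 0 < q%:R :> R by rewrite ltr0n.
have qA : 0 <= q%:R * A by rewrite mulr_ge0.
have qB : 0 <= q%:R * B by rewrite mulr_ge0 // (le_trans A0).
pose i := Num.truncn (q%:R * A); pose j := Num.truncn (q%:R * B).
have /andP[i1 i2] := truncn_itv qA; have /andP[j1 j2] := truncn_itv qB.
rewrite -/i -/j -?natr1 in i1 i2 j1 j2.
have ij : (i <= j)%N by apply: le_truncn; rewrite ler_pM2l.
have : (j - i <= count (fun a => (A <= a%:R / q%:R <= B)%R) (iota 0 q))%N.
  rewrite -size_filter -[X in (X <= _)%N](size_iota i.+1).
  apply: uniq_leq_size; first exact: iota_uniq.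
  move=> a; rewrite mem_iota mem_filter mem_iota add0n => /andP[ia aj].
  have aj' : (a <= j)%N by lia.
  have aR : a%:R <= j%:R :> R by rewrite ler_nat.
  have iR : i%:R + 1 <= a%:R :> R by rewrite natr1 ler_nat.
  rewrite ler_pdivlMr // ler_pdivrMr // !(mulrC _ q%:R).
  apply/andP; split; first by apply/andP; split; lra.
  rewrite -(ltr_nat R) /=; apply: (le_lt_trans aR); apply: (le_lt_trans j1).
  by rewrite gtr_pMr.
rewrite -(ler_nat R) natrB // => /(le_trans _); apply; lra.
Qed.

Lemma count_frac_le (q : nat) (c0 t : R) (s : seq nat) : (0 < q)%N -> 0 <= t ->
  uniq s ->
  (count (fun a => `|a%:R / q%:R - c0| <= 2 * t) s)%:R <= 4 * t * q%:R + 1.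
Proof.
move=> q0 t0 us; have q0' : 0 < q%:R :> R by rewrite ltr0n.
rewrite -size_filter -[q%:R in X in _ <= X]invrK.
apply: (@size_separated_le _ (fun a => a%:R / q%:R) _ _ (c0 - 2 * t)).
- by rewrite filter_uniq.
- by rewrite invr_gt0.
- by rewrite (@le_trans _ _ 0) ?oppr_le0 ?invr_ge0 ?(ltW q0') // mulr_ge0.
- move=> a; rewrite mem_filter ler_norml => /andP[/andP[h1 h2] _].
  by apply/andP; split; lra.
- move=> a b _ _ ab; rewrite -mulrBl normrM (ger0_norm (x := q%:R^-1)); last first.
    by rewrite invr_ge0 ltW.
  by rewrite ler_peMl ?invr_ge0 ?(ltW q0') // ler1_dist_nat.
Qed.

(* The integers [a q' - a' q] are distinct and nonzero, by the Chinese
   remainder theorem. *)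
Lemma count_close_fractions (q q' : nat) (eta : R) : (0 < q)%N -> (0 < q')%N ->
  coprime q q' -> 0 <= eta ->
  (count (fun x : nat * nat => [&& x.1 != 0%N, x.2 != 0%N &
     `|x.1%:R / q%:R - x.2%:R / q'%:R| <= eta])
     [seq (a, a') | a <- iota 0 q, a' <- iota 0 q'])%:R
  <= 2 * eta * q%:R * q'%:R.
Proof.
move=> q0 q0' cop eta0; have qR : 0 < q%:R :> R by rewrite ltr0n.
have qR' : 0 < q'%:R :> R by rewrite ltr0n.
set P := (P in count P _); set s := (s in count P s).
have us : uniq s by rewrite allpairs_uniq ?iota_uniq // => -[? ?] [? ?] _ _ [] -> ->.
have sP x : x \in s -> (x.1 < q /\ x.2 < q')%N.
  case: x => a a' /allpairsP[[b b'] /= [hb hb' [-> ->]]] /=.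
  by move: hb hb'; rewrite !mem_iota !add0n.
pose f (x : nat * nat) : R := (x.1 * q')%:R - (x.2 * q)%:R.
have fE x : x.1%:R / q%:R - x.2%:R / q'%:R = f x / (q%:R * q'%:R) :> R.
  by rewrite /f !natrM; field; rewrite !gt_eqF.
have key (x y : nat * nat) : (x.1 < q)%N -> (y.1 < q)%N ->
    (x.1 * q' + y.2 * q = y.1 * q' + x.2 * q)%N -> x = y.
  move=> xq yq E.
  wlog yx : x y xq yq E / (y.1 <= x.1)%N.
    move=> H; case: (leqP y.1 x.1) => [|/ltnW] h; first exact: H.
    by apply/esym; apply: H => //; rewrite addnC [RHS]addnC addnC [RHS]addnC E.
  have E' : ((x.1 - y.1) * q' = (x.2 - y.2) * q)%N by rewrite !mulnBl; lia.
  have : (q %| (x.1 - y.1) * q')%N by rewrite E' dvdn_mull.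
  rewrite Gauss_dvdl // => dv.
  have xy1 : x.1 = y.1.
    apply/eqP; rewrite eqn_leq yx andbT -subn_eq0 -leqn0 leqNgt; apply/negP => h.
    by move: (dvdn_leq h dv); lia.
  move: E; rewrite xy1 => /addnI /eqP; rewrite eqn_pmul2r // => /eqP xy2.
  by case: x y xy1 xy2 {xq yq yx E' dv} => [? ?] [? ?] /= -> ->.
have finj x y : x \in s -> y \in s -> x != y -> 1 <= `|f x - f y|.
  move=> /sP[x1 _] /sP[y1 _] xy.
  rewrite /f (_ : _ - _ = (x.1 * q' + y.2 * q)%:R - (y.1 * q' + x.2 * q)%:R); last first.
    by rewrite !natrD; ring.
  by apply: ler1_dist_nat; apply: contra_neq xy => /key; apply.
have f1 x : x \in s -> P x -> 1 <= `|f x|.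
  move=> /sP[x1 x2] /and3P[a0 b0 _]; apply: ler1_dist_nat.
  apply: contra_neq a0 => E.
  have := @key x (0, 0)%N x1 q0; rewrite /= mul0n addn0 add0n => /(_ E) ->.
  by [].
pose H := eta * (q%:R * q'%:R).
have H0 : 0 <= H by rewrite !mulr_ge0 // ltW.
have PH x : P x -> `|f x| <= H.
  move=> /and3P[_ _]; rewrite fE normrM normfV.
  rewrite ler_pdivrMr ?normr_gt0 ?mulf_neq0 ?gt_eqF //.
  by rewrite [`|q%:R * _|]ger0_norm // mulr_ge0 // ltW.
(* The two signs are counted apart. The values lie in [[1, H]] at mutual distance at least 1, which
   gives [H] without an additive 1; such a term would be fatal when summed over all pairs of
   primes. *)
have half (sg : R) : sg \in [:: 1; -1] ->
   (count (fun x => P x && (0 < sg * f x)) s)%:R <= H.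
  move=> hsg; have sg1 : `|sg| = 1.
    by move: hsg; rewrite !inE => /orP[] /eqP ->; rewrite ?normrN normr1.
  rewrite -size_filter (_ : H = (H - 1) / 1 + 1); last by field.
  apply: (@size_separated_le _ (fun x => sg * f x) _ _ 1); rewrite ?filter_uniq //.
  - by lra.
  - move=> x; rewrite mem_filter => /andP[/andP[Px fx] xs].
    have := f1 x xs Px; have := PH x Px.
    have -> : `|f x| = sg * f x by rewrite -(gtr0_norm fx) normrM sg1 mul1r.
    by move=> h1 h2; apply/andP; split; lra.
  - move=> x y; rewrite !mem_filter => /andP[_ xs] /andP[_ ys] xy.
    by rewrite -mulrBr normrM sg1 mul1r finj.
have := lerD (half 1 _) (half (-1) _); rewrite !inE !eqxx ?orbT => /(_ isT isT) h.
apply: le_trans (le_trans _ h) _; last by rewrite /H; lra.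
rewrite -natrD ler_nat -count_predUI; apply: leq_trans (leq_addr _ _).
rewrite -!size_filter; apply: uniq_leq_size; first exact: filter_uniq.
move=> x; rewrite !mem_filter => /andP[Px xs]; rewrite xs andbT /= Px /=.
have := f1 x xs Px; rewrite mul1r mulN1r oppr_gt0.
by case: ltrgtP => // <-; rewrite normr0; lra.
Qed.

Lemma count_allpairs_dep (P : pred (nat * nat)) (Q : seq nat) (F : nat -> seq nat) :
  count P [seq (p, a) | p <- Q, a <- F p] =
  (\sum_(p <- Q) count (fun a => P (p, a)) (F p))%N.
Proof.
by elim: Q => [|p Q IH]; rewrite ?big_nil // big_cons /= count_cat count_map IH.
Qed.

(** * Selection of good, isolated fractions *)

Section Selection.
Variables (Q : seq nat) (e : nat) (bad : nat -> pred nat) (u l rho Y s : R).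
Hypotheses (uQ : uniq Q) (Q0 : (0 < size Q)%N) (e0 : (0 < e)%N).
Hypothesis QP : forall p, p \in Q -> prime p /\ Y < p%:R.
Hypotheses (u0 : 0 <= u) (l0 : 0 < l) (ul1 : u + l <= 1) (rho0 : 0 < rho).
Hypothesis Qbad : forall p, p \in Q ->
  (count (bad p) (iota 0 (p ^ e)))%:R <= l / 4 * (p ^ e)%:R.

(** [Sg] is the number of all fractions, so [1 / Sg] is their mean spacing. Crowding is counted over
    the whole of [[0, 1)] and compared with the [l Sg] fractions expected in the interval, hence the
    factor [l] in [delta]. *)
Let Sg : R := \sum_(p <- Q) (p ^ e)%:R.
Let delta := l / (32 * Sg).
Hypothesis lY : 64 <= l * Y.
Hypothesis rhoS : 64 * rho * Sg <= l.

Let Y0 : 0 < Y. Proof. by rewrite -(pmulr_rgt0 _ l0) (lt_le_trans _ lY). Qed.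

Let q0 p : p \in Q -> (0 < p ^ e)%N.
Proof. by move=> /QP[pp _]; rewrite expn_gt0 prime_gt0. Qed.

Let Yq p : p \in Q -> Y <= (p ^ e)%:R.
Proof.
move=> /QP[pp /ltW /le_trans]; apply; rewrite ler_nat.
by rewrite -[X in (X <= _)%N]expn1; apply: leq_pexp2l => //; exact: prime_gt0.
Qed.

Let qS p : p \in Q -> (p ^ e)%:R <= Sg.
Proof.
by move=> pQ; rewrite /Sg (big_rem p) //= lerDl sumr_ge0.
Qed.

Let S0 : 0 < Sg.
Proof.
case: Q Q0 QP uQ @Sg q0 qS => // p Q' _ _ _ Sg' q0' qS'.
apply: lt_le_trans (qS' p (mem_head _ _)).
by rewrite ltr0n q0' // mem_head.
Qed.

Let delta0 : 0 < delta. Proof. by rewrite divr_gt0 // mulr_gt0. Qed.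
Let rho_delta : 2 * rho <= delta.
Proof. by rewrite /delta ler_pdivlMr ?mulr_gt0 //; move: rhoS; set S := Sg; lra. Qed.

Let all_fracs := [seq (p, a) | p <- Q, a <- iota 0 (p ^ e)].

Let uniq_all : uniq all_fracs.
Proof.
apply: allpairs_uniq_dep => //; first by move=> p _; exact: iota_uniq.
by move=> [p a] [p' a'] _ _ /= [-> ->].
Qed.

Let mem_all x : x \in all_fracs -> x.1 \in Q /\ (x.2 < x.1 ^ e)%N.
Proof.
by move=> /allpairsPdep[p [a [pQ ha ->]]] /=; rewrite mem_iota add0n in ha.
Qed.

(** Numerator 0 is left out because the fractions [0 / p^e] coincide for all [p]. *)
Let crowded (x : nat * nat) := has (fun y : nat * nat =>
  [&& y.1 != x.1, y.2 != 0%N & `|frac e x - frac e y| <= 2 * delta]) all_fracs.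

Let inside (x : nat * nat) := u + rho <= frac e x <= u + l - rho.

Let good (x : nat * nat) :=
  [&& inside x, ~~ bad x.1 x.2, x.2 != 0%N & ~~ crowded x].

Let pts := [seq x <- all_fracs | good x].

(** Distinct denominators: neither fraction is crowded. Equal denominators: the spacing is at least
    [1 / p^e >= 1 / Sg], well above [2 delta]. *)
Let pts_sep x y : x \in pts -> y \in pts -> x != y ->
  2 * delta < `|frac e x - frac e y|.
Proof.
rewrite !mem_filter => /andP[/and4P[_ _ _ gx] xa] /andP[/and4P[_ _ gy _] ya] xy.
have [x1 x2] := mem_all xa; have [y1 y2] := mem_all ya.
have [E|E] := eqVneq y.1 x.1; last first.
  rewrite ltNge; apply: contra gx => h; apply/hasP; exists y => //.
  by rewrite E gy h.
have qx : 0 < (x.1 ^ e)%:R :> R by rewrite ltr0n q0.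
rewrite /frac E -mulrBl normrM [`|_^-1|]ger0_norm ?invr_ge0 ?(ltW qx) //.
apply: (@lt_le_trans _ _ (1 / (x.1 ^ e)%:R)); last first.
  rewrite ler_wpM2r ?invr_ge0 ?(ltW qx) // ler1_dist_nat //.
  apply: contra_neq xy => h; case: x y E h {xa ya gx gy x1 x2 y1 y2 qx} => [? ?] [? ?] /=.
  by move=> -> ->.
rewrite ltr_pdivlMr // /delta.
have := qS x1; have h : 0 < 32 * Sg by rewrite mulr_gt0.
rewrite mulrA mulrAC ltr_pdivrMr //; have := S0; move: l0 ul1 u0; nra.
Qed.

(** Summing [count_close_fractions] over all pairs of primes gives [4 delta Sg^2 = l Sg / 8]. *)
Let count_crowded : (\sum_(p <- Q) count (fun a => (a != 0%N) && crowded (p, a))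
   (iota 0 (p ^ e)))%N%:R <= l / 8 * Sg.
Proof.
pose P (x y : nat * nat) := [&& x.2 != 0%N, y.2 != 0%N &
   `|frac e x - frac e y| <= 2 * delta].
pose c p p' := count (fun x : nat * nat => [&& x.1 != 0%N, x.2 != 0%N &
     `|x.1%:R / (p ^ e)%:R - x.2%:R / (p' ^ e)%:R| <= 2 * delta])
     [seq (a, a') | a <- iota 0 (p ^ e), a' <- iota 0 (p' ^ e)].
apply: (@le_trans _ _ (\sum_(p <- Q) \sum_(p' <- Q | p' != p) (c p p')%:R)).
  rewrite natr_sum; apply: ler_sum => p _; rewrite -natr_sum ler_nat.
  apply: (@leq_trans (\sum_(a <- iota 0 (p ^ e)) \sum_(p' <- Q | p' != p)
     count (fun a' => P (p, a) (p', a')) (iota 0 (p' ^ e)))).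
    rewrite -sum_nat_count; apply: leq_sum => a _.
    case: (boolP (_ && _)) => // /andP[a0 /hasP[y ya /and3P[y1 y2 h]]].
    have [yQ yq] := mem_all ya.
    rewrite (big_rem y.1) //= y1; apply: leq_trans (leq_addr _ _) => /=.
    rewrite -has_count; apply/hasP; exists y.2; first by rewrite mem_iota.
    by rewrite /P /= a0 y2; case: y h {ya y1 y2 yQ yq}.
  rewrite exchange_big /=; apply: leq_sum => p' _.
  by rewrite /c count_allpairs_dep.
apply: (@le_trans _ _ (\sum_(p <- Q) \sum_(p' <- Q) 4 * delta * (p ^ e)%:R * (p' ^ e)%:R)).
  rewrite big_seq [X in _ <= X]big_seq; apply: ler_sum => p pQ.
  rewrite big_mkcond big_seq [X in _ <= X]big_seq; apply: ler_sum => p' pQ'.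
  case: ifP => pp'; last first.
    by do 3 apply: mulr_ge0 => //; exact: ltW.
  apply: le_trans (count_close_fractions (q0 pQ) (q0 pQ') _ _) _.
  - have [h _] := QP pQ; have [h' _] := QP pQ'.
    by rewrite coprimeXl // coprimeXr // prime_coprime // dvdn_prime2 // eq_sym pp'.
  - by rewrite mulr_ge0 // ltW.
  - by lra.
under eq_bigr do rewrite -mulr_sumr -/Sg.
rewrite -mulr_suml -mulr_sumr -/Sg /delta.
rewrite [X in X <= _](_ : _ = l / 8 * Sg) //.
by field; rewrite gt_eqF.
Qed.

(** Of the [l q] fractions expected per denominator [q], bad numerators take [l q / 4], and the
    margins, rounding and numerator 0 at most [l q / 16]. Crowding takes [l Sg / 8] in total, so
    more than a quarter remains. *)
Let size_pts : l * Sg / 4 <= (size pts)%:R.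
Proof.
rewrite size_filter count_allpairs_dep.
have h1 : \sum_(p <- Q) ((p ^ e)%:R * (l - 2 * rho) - 2 - l / 4 * (p ^ e)%:R) <=
  (\sum_(p <- Q) count (fun a => good (p, a)) (iota 0 (p ^ e)))%N%:R + 
  (\sum_(p <- Q) count (fun a => (a != 0%N) && crowded (p, a)) (iota 0 (p ^ e)))%N%:R.
  rewrite !natr_sum -big_split /= big_seq [X in _ <= X]big_seq.
  apply: ler_sum => p pQ; set q := (p ^ e)%N.
  have q1 : (0 < q)%N := q0 pQ.
  have := Qbad pQ; rewrite -/q.
  have rl : 2 * rho <= l.
    apply: (le_trans rho_delta); rewrite /delta ler_pdivrMr ?mulr_gt0 //.
    rewrite ler_peMr ?(ltW l0) //.
    have := qS pQ; have : 1 <= (p ^ e)%:R :> R by rewrite ler1n q0.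
    lra.
  have c_le := @count_frac_ge q (u + rho) (u + l - rho) q1.
  have a1 : 0 <= u + rho by rewrite addr_ge0 // ltW.
  have a2 : u + rho <= u + l - rho by move: rl; lra.
  have a3 : u + l - rho < 1 by move: ul1 rho0; lra.
  have {a1 a2 a3}c_le := c_le a1 a2 a3.
  set c1 := count _ _ in c_le; set c2 := count (bad p) _.
  set c3 := count _ (iota 0 (p ^ e)); set c4 := count _ (iota 0 (p ^ e)).
  have : (c1 <= c2 + (1 + (c3 + c4)))%N.
    have -> : 1%N = count (pred1 0%N) (iota 0 q).
      by rewrite count_uniq_mem ?iota_uniq // mem_iota q1.
    rewrite /c1 /c2 /c3 /c4 -!sum_nat_count -!big_split /=; apply: leq_sum => a _.
    rewrite /good /inside /= /frac /= -/q.
    case: (_ <= _ <= _) => //=; case: (bad p a) => //=; case: (a == 0%N) => //=.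
    by case: (crowded _).
  rewrite -(ler_nat R) !natrD. lra.
have h2 := le_trans h1 (lerD (lexx _) count_crowded).
suff : l * Sg * (5 / 8) <= \sum_(p <- Q) ((p ^ e)%:R * (l - 2 * rho) - 2 - l / 4 * (p ^ e)%:R).
  have := mulr_gt0 l0 S0; move: h2; set c := (\sum_(p <- Q) _)%N%:R; set S := Sg; lra.
rewrite -mulrA mulrC -mulrA {1}/Sg mulr_suml big_seq [X in _ <= X]big_seq.
apply: ler_sum => p pQ; have := Yq pQ; have := qS pQ.
have p64 : 64 <= (p ^ e)%:R * l.
  by apply: (le_trans lY); rewrite mulrC ler_wpM2r ?Yq // ltW.
have : 64 * (rho * (p ^ e)%:R) <= 64 * (rho * Sg).
  by rewrite ler_pM2l // ler_pM2l // qS.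
have : l <= (p ^ e)%:R * l by rewrite ler_peMl ?ler1n ?q0 // ltW.
move: rhoS p64; set S := Sg; set q := (p ^ e)%:R => *; lra.
Qed.


Hypotheses (s01 : 0 < s < 1) (lYs : 20 <= l * (l * Y) `^ (1 - s)).
Hypothesis mass : 16 * l `^ s <= l * Sg * (2 * rho) `^ s.

Let s0 : 0 < s. Proof. by case/andP: s01. Qed.

Let frac_inj : {in pts &, injective (frac e)}.
Proof.
move=> x y xp yp E; apply/eqP; apply: contraT => xy.
have := pts_sep xp yp xy; rewrite E subrr normr0 ltNge.
by rewrite mulr_ge0 // ltW.
Qed.

Let uniq_pts : uniq pts. Proof. by rewrite filter_uniq. Qed.

(** A window of length at least [1 / Y] is long for every denominator, so rounding at most adds
    [t p^e] to the [4 t p^e] expected. *)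
Let count_long c0 t : 0 <= t -> 1 <= t * Y ->
  (count (fun x => `|frac e x - c0| <= 2 * t) pts)%:R <= 5 * t * Sg.
Proof.
move=> t0 tY.
apply: (@le_trans _ _ (count (fun x => `|frac e x - c0| <= 2 * t) all_fracs)%:R).
  by rewrite ler_nat; apply: leq_count_subseq; exact: filter_subseq.
rewrite count_allpairs_dep natr_sum /Sg mulr_sumr big_seq [X in _ <= X]big_seq.
apply: ler_sum => p pQ.
apply: (le_trans (count_frac_le c0 (q0 pQ) t0 (iota_uniq _ _))).
have : 1 <= t * (p ^ e)%:R by apply: (le_trans tY); rewrite ler_wpM2l // Yq.
lra.
Qed.

(** Below [1 / Y] only the separation is available, and it loses a factor [1 / l];
    [fractions_branching] recovers it. *)
Let count_short c0 t : delta <= t ->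
  (count (fun x => `|frac e x - c0| <= 2 * t) pts)%:R <= 96 * (t * Sg / l).
Proof.
move=> dt; rewrite -size_filter.
have t0 : 0 <= t by apply: le_trans dt; exact: ltW.
have d2 : 0 < 2 * delta by rewrite mulr_gt0.
apply: (@le_trans _ _ (4 * t / (2 * delta) + 1)).
  apply: (@size_separated_le _ (frac e) _ _ (c0 - 2 * t)) => //.
  - exact: filter_uniq.
  - by rewrite (@le_trans _ _ 0) ?oppr_le0 ?(ltW d2) // mulr_ge0.
  - move=> x; rewrite mem_filter ler_norml => /andP[/andP[h1 h2] _].
    by apply/andP; split; lra.
  - move=> x y; rewrite !mem_filter => /andP[_ xp] /andP[_ yp] xy.
    by apply/ltW/pts_sep; rewrite ?mem_filter.
have E : t / delta = 32 * (t * Sg / l).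
  by rewrite /delta; field; rewrite !gt_eqF.
have : 1 <= t / delta by rewrite ler_pdivlMr // mul1r.
have -> : 4 * t / (2 * delta) = 2 * (t / delta) by field; rewrite gt_eqF.
rewrite E; lra.
Qed.

Let powR_ge_id (x : R) : 0 < x -> x <= 1 -> x <= x `^ s.
Proof.
by move=> x0 x1; apply: ger1_powR; rewrite ?x0 //; case/andP: s01 => _ /ltW.
Qed.

(** For long windows [t / l <= (t / l) ^ s] suffices. For [t < 1 / Y], the power [(t / l) ^ s]
    exceeds [t / l] by the factor [(l / t) ^ (1 - s)], at least [20 / l] by [lYs], which absorbs the
    loss in [count_short]. The hypothesis [mass] is matched to the count [l Sg / 4]. *)
Lemma fractions_branching P eps : delta <= eps ->
  (forall p a, p \in Q -> ~~ bad p a ->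
    forall x, `|x - a%:R / (p ^ e)%:R| <= rho -> P x) ->
  branching s P u l eps.
Proof.
move=> deps hP; have lS0 : 0 < l * Sg by rewrite mulr_gt0.
have m0 : (0 < size pts)%N.
  by rewrite -(ltr_nat R); apply: lt_le_trans size_pts; rewrite divr_gt0.
exists (map (frac e) pts), rho, delta; split => //.
- by rewrite size_map.
- by move=> c /mapP[x]; rewrite mem_filter => /andP[/andP[h _] _] ->.
- move=> c y /mapP[x]; rewrite mem_filter => /andP[/and4P[_ bx _ _] /mem_all[xQ _]] -> {c}.
  exact: hP.
split.
- by rewrite map_inj_in_uniq.
- move=> _ _ /mapP[x xp ->] /mapP[y yp ->] xy; apply: pts_sep => //.
  by apply: contra_neq xy => ->.
- move=> c0 t /andP[dt tl]; rewrite count_map size_map.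
  have t0 : 0 < t by exact: lt_le_trans dt.
  have tl0 : 0 < t / l by rewrite divr_gt0.
  have tl1 : t / l <= 1 by rewrite ler_pdivrMr // mul1r.
  have sz : 5 * (l * Sg) * (t / l) `^ s <= 20 * (size pts)%:R * (t / l) `^ s.
    by rewrite ler_wpM2r ?powR_ge0 //; have := size_pts; lra.
  apply: le_trans sz; have [tY|tY] := leP 1 (t * Y).
    apply: (le_trans (count_long c0 (ltW t0) tY)).
    have -> : 5 * t * Sg = 5 * (l * Sg) * (t / l) by field; rewrite gt_eqF.
    by rewrite ler_wpM2l ?powR_ge_id // mulr_ge0 // ltW.
  apply: (le_trans (count_short c0 dt)).
  have -> : (t / l) `^ s = (t / l) * (l / t) `^ (1 - s).
    rewrite -[l / t]invf_div; set y := t / l in tl0 *.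
    rewrite -[y^-1]powR_inv1 ?ltW // -powRrM mulN1r opprB.
    rewrite -[X in X * _]powRr1 ?ltW // -powRD; last by apply/implyP => _; rewrite gt_eqF.
    by congr (_ `^ _); ring.
  have : 20 / l <= (l / t) `^ (1 - s).
    rewrite ler_pdivrMr // mulrC; apply: (le_trans lYs); rewrite ler_pM2l //.
    apply: ge0_ler_powR; rewrite ?nnegrE ?mulr_ge0 ?invr_ge0 ?ltW //.
      by case/andP: s01; rewrite subr_gt0.
    by rewrite ltr_pM2l // -div1r ltr_pdivlMr // mulrC.
  set z := _ `^ _ => hz.
  have -> : 5 * (l * Sg) * (t / l * z) = 5 * (t * Sg) * z by field; rewrite gt_eqF.
  have : 5 * (t * Sg) * (20 / l) <= 5 * (t * Sg) * z.
    by rewrite ler_wpM2l // !mulr_ge0 // ltW.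
  have := divr_gt0 (mulr_gt0 t0 S0) l0; set S := Sg; lra.
- rewrite size_map; have := mass; have := size_pts.
  have := powR_gt0 s (mulr_gt0 (ltr0Sn R 1) rho0); set z := (2 * rho) `^ s => z0 h1 h2.
  have := ler_wpM2r (ltW z0) h1; lra.
Qed.

End Selection.

End Fractions.

(** * Hausdorff dimension *)

Lemma exists_uniform (T : eqType) (s : seq T) (A : nat -> T -> Prop) :
  (forall m n x, (m <= n)%N -> A m x -> A n x) ->
  (forall x, x \in s -> exists n, A n x) -> exists n, forall x, x \in s -> A n x.
Proof.
move=> mono; elim: s => [|x s IH] h; first by exists 0%N.
have [n1 h1] : exists n, A n x by apply: h; rewrite mem_head.
have [n2 h2] : exists n, forall x, x \in s -> A n x.
  by apply: IH => y ys; apply: h; rewrite inE ys orbT.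
exists (maxn n1 n2) => y; rewrite inE => /orP[/eqP ->|ys].
  exact: mono (leq_maxl _ _) h1.
exact: mono (leq_maxr _ _) (h2 _ ys).
Qed.

(** * Descent that avoids a countable cover *)

Section MassAvoidance.
Context {R : realType}.
Variables (U : nat -> set R) (t : nat -> R) (s : R).
Hypotheses (t0 : forall i, 0 < t i) (s0 : 0 < s).
Hypothesis Ut : forall i x y, U i x -> U i y -> `|x - y| <= t i.

Definition hits (i : nat) (u l : R) : bool :=
  `[< exists2 x, U i x & u <= x <= u + l >].

Definition light (u l : R) : Prop :=
  forall n, \sum_(i < n | hits i u l) t i `^ s <= l `^ s / 80.

Let ts0 i : 0 <= t i `^ s. Proof. exact: powR_ge0. Qed.

(** A longer set would exceed the budget [l ^ s / 80] by its own term. This makes every set that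
    meets a light interval admissible for the window bound, which requires [t <= l]. *)
Lemma light_hits_le u l i : 0 < l -> light u l -> hits i u l -> t i <= l.
Proof.
move=> l0 lt hi; rewrite leNgt; apply/negP => il.
have := lt i.+1; rewrite big_mkcond big_ord_recr /= hi.
have : 0 <= \sum_(j < i) (if hits j u l then t j `^ s else 0).
  by apply: sumr_ge0 => j _; case: ifP.
have : l `^ s <= t i `^ s.
  by apply: ge0_ler_powR; rewrite ?nnegrE ltW.
by have := powR_gt0 s l0; lra.
Qed.

(* Weigh a set of diameter at least [delta] by 1 and a shorter one by its
   share of the budget of a child.  The children then have total weight less
   than their number, so one of them has weight less than 1. *)
Lemma light_child (P : R -> Prop) u l eps : 0 < l -> light u l ->
  branching s P u l eps ->
  exists u' l', [/\ 0 < l', u <= u' /\ u' + l' <= u + l, light u' l',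
    forall x, u' <= x <= u' + l' -> P x &
    forall i, hits i u' l' -> t i < eps].
Proof.
move=> l0 lul [cs [rho [delta [[rho0 rd deps] m0 csin csP [ucs sep win mass]]]]].
pose h i c := hits i (c - rho) (2 * rho).
have hI i c : h i c -> exists2 x, U i x & `|x - c| <= rho.
  by move=> /asboolP[x Ux hx]; exists x => //; rewrite ler_norml; apply/andP; split; lra.
suff [c ccs [c1 c2]] : exists2 c, c \in cs & 
   light (c - rho) (2 * rho) /\ forall i, h i c -> t i < delta.
  have cc := csin c ccs.
  exists (c - rho), (2 * rho); split => //.
  - by rewrite mulr_gt0.
  - by split; lra.
  - by move=> x hx; apply: (csP c) => //; rewrite ler_norml; apply/andP; split; lra.
  - by move=> i /c2 hi; apply: lt_le_trans deps.
apply: contrapT => hno.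
set z := (2 * rho) `^ s; have z0 : 0 < z by rewrite powR_gt0 ?mulr_gt0.
pose wt i := if delta <= t i then 1 else t i `^ s / (z / 80).
have z80 : 0 < z / 80 by rewrite divr_gt0.
have wt0 i : 0 <= wt i.
  by rewrite /wt; case: ifP => // _; apply: divr_ge0 => //; exact: ltW.
pose Psi n c := \sum_(i < n) (h i c)%:R * wt i.
have hw0 i c : 0 <= (h i c)%:R * wt i by rewrite mulr_ge0.
have Psi_mono m n c : (m <= n)%N -> 1 <= Psi m c -> 1 <= Psi n c.
  move=> mn h1; apply: (le_trans h1); rewrite /Psi.
  rewrite -(big_mkord xpredT (fun i => (h i c)%:R * wt i)).
  rewrite -[X in _ <= X](big_mkord xpredT (fun i => (h i c)%:R * wt i)).
  by rewrite [X in _ <= X](big_cat_nat (n := m)) //= lerDl sumr_ge0.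
(* If no child is suitable, each has weight at least 1 in some partial sum; there are finitely many
   children, so one truncation serves all. *)
have [n hn] : exists n, forall c, c \in cs -> 1 <= Psi n c.
  apply: (@exists_uniform _ cs (fun n c => 1 <= Psi n c)) => [a b c|c ccs].
    exact: Psi_mono.
  apply: contrapT => hc; apply: hno; exists c => //.
  have small i : h i c -> t i < delta.
    move=> hi; rewrite ltNge; apply/negP => di; apply: hc; exists i.+1.
    rewrite /Psi big_ord_recr /= hi mul1r /wt di lerDr.
    by apply: sumr_ge0 => j _.
  split => // n; rewrite leNgt; apply/negP => big; apply: hc; exists n.
  rewrite /Psi (eq_bigr (fun i : 'I_n => (if h i c then t i `^ s else 0) / (z / 80))).
    rewrite -mulr_suml -big_mkcond ler_pdivlMr ?divr_gt0 // mul1r.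
    exact: ltW.
  move=> i _; rewrite /wt; case: (boolP (h i c)) => [hi|_]; last by rewrite !mul0r.
  by rewrite leNgt small //= mul1r.
set m := size cs in m0 mass win.
have m0' : 0 < m%:R :> R by rewrite ltr0n.
have l0s : 0 < l `^ s by rewrite powR_gt0.
have sub i c : c \in cs -> h i c -> hits i u l.
  move=> ccs /asboolP[x Ux hx]; apply/asboolP; exists x => //.
  by have := csin c ccs; lra.
(* A set with [t i >= delta] meets only children within [t i + 2 rho <= 2 t i] of one another, which
   the window bound counts. A shorter one meets at most one child, since centres are more than
   [2 delta] apart. *)
have cnt i : hits i u l -> (count (h i) cs)%:R * wt i <=
    t i `^ s * (20 * m%:R / l `^ s + 80 / z).
  move=> hi; have til := light_hits_le l0 lul hi.
  have A0 : 0 <= 20 * m%:R / l `^ s by rewrite divr_ge0 ?mulr_ge0 ?ltW.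
  have B0 : 0 <= 80 / z by rewrite divr_ge0 ?ltW.
  have rhs0 : 0 <= t i `^ s * (20 * m%:R / l `^ s + 80 / z).
    by rewrite mulr_ge0 // addr_ge0.
  case: (boolP (has (h i) cs)) => [/hasP[c0 c0cs hc0]|]; last first.
    by rewrite has_count -leqNgt leqn0 => /eqP ->; rewrite mul0r.
  have close c : h i c -> `|c - c0| <= t i + 2 * rho.
    move=> /hI[y Uy hy]; have [x Ux hx] := hI _ _ hc0.
    have := Ut Uy Ux; move: hx hy; rewrite !ler_norml => ? ? ?; apply/andP; split; lra.
  rewrite /wt; case: (leP delta (t i)) => [di|di].
    rewrite mulr1; apply: (@le_trans _ _ (20 * m%:R * (t i / l) `^ s)).
      apply: le_trans (win c0 (t i) _); last by rewrite di til.
      rewrite ler_nat; apply: sub_count => c /close /le_trans; apply; lra.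
    rewrite powRM ?invr_ge0 ?(ltW l0) ?(ltW (t0 i)) // [l^-1 `^ s](_ : _ = (l `^ s)^-1); last first.
      by rewrite -[l^-1]powR_inv1 ?ltW // -powRrM mulN1r powRN.
    rewrite mulrDr; have := mulr_ge0 (ts0 i) B0.
    by set il := (_ `^ _)^-1; set iz := z^-1; lra.
  apply: (@le_trans _ _ (1 * (t i `^ s / (z / 80)))).
    apply: ler_wpM2r; first by rewrite divr_ge0 // divr_ge0 ?ltW.
    rewrite -[X in _ <= X](mulr1n 1) ler_nat.
    apply: (@leq_trans (count_mem c0 cs)); last by rewrite count_uniq_mem // leq_b1.
    rewrite -[X in (X <= _)%N](_ : count (fun c => h i c && (c == c0)) cs = _).
      by apply: sub_count => c /andP[].
    apply: eq_in_count => c ccs; case: (boolP (h i c)) => //= hc.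
    apply: contraT => cc0.
    by have := sep _ _ ccs c0cs cc0; have := close c hc; lra.
  rewrite mul1r mulrDr; have := mulr_ge0 (ts0 i) A0.
  by rewrite invf_div; set il := (_ `^ _)^-1; set iz := z^-1; lra.
have : m%:R <= \sum_(c <- cs) Psi n c.
  rewrite -[m%:R]mulr1n -[m]count_predT natr_count big_seq [X in _ <= X]big_seq.
  by apply: ler_sum => c /hn.
rewrite /Psi exchange_big /=.
have : \sum_(i < n) \sum_(c <- cs) (h i c)%:R * wt i <=
   \sum_(i < n | hits i u l) t i `^ s * (20 * m%:R / l `^ s + 80 / z).
  rewrite [X in _ <= X]big_mkcond /=; apply: ler_sum => i _.
  rewrite -mulr_suml -natr_count; case: ifP => hi; first exact: cnt.
  rewrite (_ : count _ _ = 0%N) ?mul0r //; apply/eqP.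
  rewrite -leqn0 leqNgt -has_count; apply/hasP => -[c ccs /(sub _ _ ccs)].
  by rewrite hi.
rewrite -mulr_suml => h1 h2; have {h1 h2} := le_trans h2 h1.
have AB0 : 0 <= 20 * m%:R / l `^ s + 80 / z.
  by rewrite addr_ge0 // divr_ge0 ?mulr_ge0 ?ltW.
have := ler_wpM2r AB0 (lul n).
(* The total weight is at most [m / 4 + m / 4], less than the number [m] of children. *)
have -> : l `^ s / 80 * (20 * m%:R / l `^ s + 80 / z) = m%:R / 4 + l `^ s / z.
  by field; rewrite !gt_eqF.
have : l `^ s / z <= m%:R / 4 by rewrite ler_pdivrMr //; move: mass; rewrite -/z; lra.
lra.
Qed.

(** At step [k] the child is taken with [eps = 1 / (k + 1)]. A set [U i] containing the limit point
    would meet every interval, so [t i < 1 / (k + 1)] for all [k], against [t i > 0]. *)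
Lemma not_cover_of_branching (E : set R) (P : nat -> R -> Prop) (u0 l0 : R) : 0 < l0 ->
  (forall M (u l eps : R), 0 < l -> u0 <= u -> u + l <= u0 + l0 -> 0 < eps ->
    branching s (P M) u l eps) ->
  (forall x, u0 <= x <= u0 + l0 -> (forall M, P M x) -> E x) ->
  (forall n, \sum_(i < n) t i `^ s <= l0 `^ s / 80) ->
  ~ (E `<=` \bigcup_i U i).
Proof.
move=> l00 hbr hE ht EU.
(* The invariants are bundled with the interval so that choice yields a total successor function to
   iterate. *)
pose V := {p : R * R | [/\ 0 < p.2, u0 <= p.1, p.1 + p.2 <= u0 + l0 & light p.1 p.2]}.
pose rel (a : nat * V) (v : V) :=
  [/\ (sval a.2).1 <= (sval v).1,
      (sval v).1 + (sval v).2 <= (sval a.2).1 + (sval a.2).2,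
      forall x, (sval v).1 <= x <= (sval v).1 + (sval v).2 -> P a.1 x &
      forall i, hits i (sval v).1 (sval v).2 -> t i < a.1.+1%:R^-1].
have /choice[F hF] : forall a, exists v, rel a v.
  move=> [k [[u l] /= [l1 ul ull lt]]].
  have e0 : 0 < k.+1%:R^-1 :> R by rewrite invr_gt0.
  have [u' [l' [l'0 [uu' uul'] lt' hP hh]]] := light_child l1 lt (hbr k u l _ l1 ul ull e0).
  have h : [/\ 0 < (u', l').2, u0 <= (u', l').1, (u', l').1 + (u', l').2 <= u0 + l0
     & light (u', l').1 (u', l').2].
    by split => //=; [exact: le_trans uu'|exact: le_trans ull].
  by exists (exist _ (u', l') h).
have light0 : light u0 l0.
  move=> n; apply: le_trans (ht n); rewrite big_mkcond /=; apply: ler_sum => i _.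
  by case: ifP.
have h0 : [/\ 0 < (u0, l0).2, u0 <= (u0, l0).1, (u0, l0).1 + (u0, l0).2 <= u0 + l0
     & light (u0, l0).1 (u0, l0).2] by split.
pose v := fix v k : V := if k is k'.+1 then F (k', v k') else exist _ (u0, l0) h0.
have vS k : rel (k, v k) (v k.+1) by exact: hF.
pose a k := (sval (v k)).1; pose b k := (sval (v k)).1 + (sval (v k)).2.
have ab k : a k <= b k.
  by rewrite /a /b; case: (v k) => -[? ?] /= [/ltW h _ _ _]; rewrite lerDl.
have amono j k : a j <= a (j + k)%N.
  elim: k => [|k IH]; first by rewrite addn0.
  by apply: (le_trans IH); rewrite addnS; have [] := vS (j + k)%N.
have bmono j k : b (j + k)%N <= b j.
  elim: k => [|k IH]; first by rewrite addn0.
  by apply: le_trans IH; rewrite addnS; have [] := vS (j + k)%N.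
have ale j k : a j <= b k.
  case: (leqP j k) => [/subnKC <-|/ltnW /subnKC <-].
    exact: le_trans (amono _ _) (ab _).
  exact: le_trans (ab _) (bmono _ _).
pose x := sup (range a).
have rx : has_sup (range a).
  by split; [exists (a 0%N); exists 0%N|exists (b 0%N) => _ [k _ <-]; exact: ale].
have ax k : a k <= x by apply: sup_upper_bound => //; exists k.
have xb k : x <= b k.
  by apply: ge_sup; [exists (a 0%N); exists 0%N|move=> _ [j _ <-]; exact: ale].
have Ex : E x.
  apply: hE; first by have := ax 0%N; have := xb 0%N; rewrite /a /b /= => -> ->.
  move=> M; have [_ _ h _] := vS M; apply: h.
  by have := ax M.+1; have := xb M.+1; rewrite /a /b => -> ->.
have [i _ Ui] := EU x Ex.
have small k : t i < k.+1%:R^-1.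
  have [_ _ _ h] := vS k; apply: h; apply/asboolP; exists x => //.
  by have := ax k.+1; have := xb k.+1; rewrite /a /b => -> ->.
have := small (Num.truncn (t i)^-1); have := truncnS_gt (t i)^-1.
rewrite invf_plt ?posrE // => h1 h2; by have := lt_trans h1 h2; rewrite ltxx.
Qed.
End MassAvoidance.

Section Dimension.
Context {R : realType}.

(** Vanishing [s]-dimensional measure with [s < b] provides a cheap cover by sets of diameter at
    most 1. The descent runs with an exponent [s'] strictly between [s] and [b]: it is positive even
    if [s = 0], and [r ^ s' <= r ^ s] for such diameters. *)
Lemma hausdorff_dim_ge (E : set R) (P : nat -> R -> Prop) (u0 l0 b : R) :
  0 < l0 -> 0 < b -> 
  (forall s, 0 < s < b -> forall M u l eps, 0 < l -> u0 <= u -> u + l <= u0 + l0 -> 0 < eps ->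
    branching s (P M) u l eps) ->
  (forall x, u0 <= x <= u0 + l0 -> (forall M, P M x) -> E x) ->
  (b%:E <= hausdorff_dim E)%E.
Proof.
move=> l00 b0 hbr hE; apply: le_ereal_inf_tmp => _ [s [s0 Hs] <-].
rewrite lee_fin leNgt; apply/negP => sb.
pose s' := (s + b) / 2.
have s'0 : 0 < s' by rewrite /s'; lra.
have ss' : s <= s' by rewrite /s'; lra.
have s'b : 0 < s' < b by rewrite s'0 /s'; lra.
pose eta := l0 `^ s' / 160.
have eta0 : 0 < eta by rewrite divr_gt0 ?powR_gt0.
have : (hausdorff_content s 1 E < eta%:E)%E.
  apply: (@le_lt_trans _ _ 0%E); last by rewrite lte_fin.
  by rewrite -Hs; apply: ereal_sup_ubound; exists 1 => //=.
move=> /ereal_inf_lt[_ [U [EU dU] <-] sU].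
have dpow i : exists2 r : R, (0 <= r /\ diameter_pow s (U i) = r%:E) &
   forall x y, U i x -> U i y -> `|x - y| `^ s' <= r.
  rewrite /diameter_pow; case: eqVneq => [->|]; first by exists 0.
  move=> /set0P[z Uz].
  have d0 x y : U i x -> U i y -> (`|x - y|%:E <= diameter (U i))%E.
    by move=> Ux Uy; apply: ereal_sup_ubound; exists (x, y).
  have := d0 _ _ Uz Uz; have := dU i; have := d0.
  case: (diameter (U i)) => [r| |] //.
  rewrite subrr normr0 !lee_fin => d1 r1 r0.
  exists (r `^ s); first by split => //; exact: powR_ge0.
  move=> x y Ux Uy; have := d1 _ _ Ux Uy; rewrite lee_fin => xyr.
  apply: (@le_trans _ _ (r `^ s')); first by apply: ge0_ler_powR; rewrite ?nnegrE ?(ltW s'0).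
  have [->|rn0] := eqVneq r 0; first by rewrite powR0 ?gt_eqF // powR_ge0.
  by apply: ger_powR => //; rewrite r1 lt0r rn0 r0.
pose D i := sval (cid2 (dpow i)).
have D1 i : 0 <= D i /\ diameter_pow s (U i) = (D i)%:E by rewrite /D; case: cid2.
have D2 i x y : U i x -> U i y -> `|x - y| `^ s' <= D i by rewrite /D; case: cid2 => r /= _; apply.
(* The added terms make [t i] positive even for empty sets and singletons. They and the cover each
   cost at most [eta], half of the budget [l0 ^ s' / 80]. *)
pose w i := D i + eta / 2 ^+ i.+1.
have w0 i : 0 < w i.
  by rewrite /w; have [h _] := D1 i; apply: ltr_wpDl => //; rewrite divr_gt0 ?exprn_gt0.
pose t i := w i `^ (s'^-1).
have tw i : t i `^ s' = w i by rewrite /t -powRrM mulVf ?gt_eqF // powRr1 // ltW.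
apply: (@not_cover_of_branching R U t s' _ s'0 _ E P u0 l0 l00 _ hE _ EU).
- by move=> i; exact: powR_gt0.
- move=> i x y Ux Uy.
  have -> : `|x - y| = (`|x - y| `^ s') `^ (s'^-1).
    by rewrite -powRrM mulfV ?gt_eqF // powRr1.
  apply: ge0_ler_powR; rewrite ?nnegrE ?powR_ge0 ?invr_ge0 ?(ltW s'0) ?(ltW (w0 i)) //.
  apply: (le_trans (D2 _ _ _ Ux Uy)); rewrite /w lerDl.
  by rewrite divr_ge0 ?(ltW eta0) // exprn_ge0.
- by move=> M u l eps; exact: hbr.
- move=> n; under eq_bigr do rewrite tw.
  rewrite big_split /=.
  have h1 : \sum_(i < n) D i <= eta.
    rewrite -lee_fin -sumEFin; apply: le_trans (ltW sU).
    have -> : (\sum_(i < n) (D i)%:E = \sum_(0 <= i < n) diameter_pow s (U i))%E.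
      by rewrite big_mkord; apply: eq_bigr => i _; have [_ ->] := D1 i.
    apply: nneseries_lim_ge => i _ _.
    by have [Di ->] := D1 i; rewrite lee_fin.
  have h2 : \sum_(i < n) eta / 2 ^+ i.+1 = eta - eta / 2 ^+ n.
    elim: n {h1} => [|n IH]; first by rewrite big_ord0 expr0 divr1 subrr.
    by rewrite big_ord_recr /= IH exprS; field; rewrite expf_neq0.
  have h3 : 0 <= eta / 2 ^+ n by rewrite divr_ge0 ?exprn_ge0 ?(ltW eta0).
  have -> : l0 `^ s' / 80 = eta + eta by rewrite /eta; field.
  by rewrite h2; lra.
Qed.
End Dimension.

(** * Choice of parameters *)

Section Scales.
Context {R : realType}.

Lemma le_powR_of_root_le (A x r : R) : 0 <= A -> 0 <= x -> 0 < r ->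
  A `^ r^-1 <= x -> A <= x `^ r.
Proof.
move=> A0 x0 r0 h.
rewrite -[A]powRr1 // -(mulVf (lt0r_neq0 r0)) powRrM.
by apply: ge0_ler_powR; rewrite ?nnegrE ?powR_ge0 ?(ltW r0).
Qed.

Lemma exists_pow2_large (b : nat) (A : R) :
  exists j, [/\ (0 < j)%N, (4 * (b * j) < 2 ^ j)%N & A <= (2 ^ j)%:R].
Proof.
pose i := (8 * b + (Num.truncn A).+1)%N; exists (2 * i)%N.
have i2 : (i < 2 ^ i)%N by exact: ltn_expl.
have sq : (2 ^ (2 * i) = 2 ^ i * 2 ^ i)%N by rewrite mul2n -addnn expnD.
split; first by rewrite /i; lia.
  rewrite sq; have b8 : (8 * b <= i)%N by rewrite leq_addr.
  nia.
apply: (le_trans (ltW (truncnS_gt A))); rewrite ler_nat sq.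
apply: (@leq_trans i); first by rewrite leq_addl.
by apply: leq_trans (ltnW i2) _; rewrite leq_pmulr ?expn_gt0.
Qed.

(** With [n = 2 ^ j], [X = n ^ b] and [Y = n ^ (b - 1)], at least [Y] primes are available and the
    right side is at least [n ^ ((b - 1) (e + 1))]. The left side is a constant times
    [n ^ (b sigma (1 + k))]; a large [b] keeps the exponent gap [gam] positive. *)
Lemma exists_parameters (e : nat) (k sigma C : R) : 0 < k -> 0 < sigma -> 0 < C ->
  sigma * (1 + k) < e%:R + 1 ->
  exists X Y K : nat, exists Q : seq nat,
  [/\ uniq Q /\ (0 < size Q)%N,
      forall p, p \in Q -> [/\ prime p, (Y < p)%N & (p <= X)%N],
      C <= Y%:R,
      X%:R `^ k <= K%:R &
      C * (K%:R * X%:R) `^ sigma <= (size Q)%:R * Y%:R ^+ e].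
Proof.
move=> k0 sg0 C0 hs; pose del := e%:R + 1 - sigma * (1 + k).
have del0 : 0 < del by rewrite subr_gt0.
(* The extra unit makes [b - 1] positive, so that [Y >= n]. *)
pose b := (Num.truncn ((e%:R + 1) / del)).+2.
have bR : (e%:R + 1) / del < b%:R.
  by apply: lt_trans (truncnS_gt _) _; rewrite ltr_nat.
pose gam := (b%:R - 1) * (e%:R + 1) - b%:R * (sigma * (1 + k)).
have gam0 : 0 < gam.
  by move: bR; rewrite ltr_pdivrMr // /gam /del; lra.
pose A := Num.max C ((C * 2 `^ sigma) `^ gam^-1).
have [j [j0 bj jA]] := exists_pow2_large b A.
have b0 : (0 < b)%N by [].
pose n : R := (2 ^ j)%:R.
have n0 : 0 < n by rewrite ltr0n expn_gt0.
have n1 : 1 <= n by rewrite ler1n expn_gt0.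
pose X := (2 ^ (b * j))%N; pose Y := (2 ^ (b.-1 * j))%N.
have XE : X%:R = n ^+ b :> R by rewrite /n -natrX -expnM mulnC.
have YE : Y%:R = n ^+ b.-1 :> R by rewrite /n -natrX -expnM mulnC.
have X0 : 0 < X%:R :> R by rewrite XE exprn_gt0.
have Y0 : 0 < Y%:R :> R by rewrite YE exprn_gt0.
have X1 : 1 <= X%:R :> R by rewrite XE exprn_ege1.
pose K := (Num.truncn (X%:R `^ k)).+1.
have XK : X%:R `^ k <= K%:R by exact/ltW/truncnS_gt.
have K2 : K%:R <= 2 * X%:R `^ k.
  have h1 : X%:R `^ 0 <= X%:R `^ k by apply: ler_powR => //; exact: ltW.
  rewrite powRr0 in h1.
  rewrite /K -natr1; have : (Num.truncn (X%:R `^ k))%:R <= X%:R `^ k by rewrite truncn_le powR_ge0.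
  lra.
pose Q := [seq p <- iota 0 X.+1 | prime p && (Y < p)%N].
have szQ : (Y <= size Q)%N.
  by rewrite size_filter; apply: count_primes_dyadic.
have Y0n : (0 < Y)%N by rewrite expn_gt0.
exists X, Y, K, Q; split => //.
- by rewrite filter_uniq ?iota_uniq //; split => //; exact: leq_trans szQ.
- move=> p; rewrite mem_filter mem_iota add0n ltnS.
  by move=> /andP[/andP[-> ->] /andP[_ ->]].
- apply: (@le_trans _ _ A); first by rewrite le_max lexx.
  by apply: (le_trans jA); rewrite YE -/n ler_eXnr.
- apply: (@le_trans _ _ (C * (2 * n `^ (b%:R * (1 + k))) `^ sigma)).
    rewrite ler_pM2l //; apply: ge0_ler_powR.
    + exact: ltW.
    + by rewrite nnegrE mulr_ge0.
    + by rewrite nnegrE mulr_ge0 // powR_ge0.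
    apply: (@le_trans _ _ (2 * X%:R `^ k * X%:R)); first by rewrite ler_pM2r.
    rewrite -mulrA ler_pM2l // XE -powR_mulrn ?(ltW n0) // -powRrM -powRD.
      by rewrite (_ : b%:R * k + b%:R = b%:R * (1 + k)) //; ring.
    by apply/implyP => _; rewrite gt_eqF.
  rewrite powRM ?powR_ge0 // -powRrM mulrA.
  apply: (@le_trans _ _ (n `^ gam * n `^ (b%:R * (1 + k) * sigma))).
    rewrite ler_pM2r ?powR_gt0 //; apply: le_powR_of_root_le => //.
      by rewrite mulr_ge0 ?powR_ge0 // ltW.
    by apply: le_trans jA; rewrite le_max lexx orbT.
  rewrite -powRD; last by apply/implyP => _; rewrite gt_eqF.
  apply: (@le_trans _ _ (Y%:R * Y%:R ^+ e)).
    rewrite -exprS YE -exprM -powR_mulrn ?(ltW n0) // natrM.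
    rewrite (_ : gam + _ = b.-1%:R * e.+1%:R) // /gam.
    have -> : b%:R = b.-1%:R + 1 :> R by rewrite natr1.
    by rewrite -[e.+1%:R]natr1; ring.
  by rewrite ler_pM2r ?exprn_gt0 // ler_nat.
Qed.

Definition large_after (alpha : R) (d M : nat) (x : R) : Prop :=
  exists N : nat, [/\ (M <= N)%N, (0 < N)%N &
    N%:R `^ alpha <= monomial_discrepancy d x N].

(** The bound [d s (1 + k) < e + 1] gives the children enough mass at exponent [s];
    [e + 1 < d (1 + k)] makes the radius [rho], of order [(K X)^(-d)], small against the spacing
    [X^(-(e+1))]. *)
Lemma branching_large_discrepancy (d e : nat) (alpha k s : R) :
  (0 < d)%N -> (0 < e)%N -> 0 < k -> 0 < s < 1 ->
  d%:R * s * (1 + k) < e%:R + 1 -> e%:R + 1 < d%:R * (1 + k) ->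
  (forall l : R, 0 < l <= 1 -> exists C w : R, [/\ 0 < w, 0 < C &
    forall (X K p : nat) (rho : R), prime p -> (p <= X)%N -> C <= p%:R ->
      X%:R `^ k <= K%:R -> 0 < rho -> rho * (K%:R * X%:R) ^+ d <= w ->
      exists bad : pred nat,
        (count bad (iota 0 (p ^ e)))%:R <= l / 4 * (p ^ e)%:R /\
        forall a, ~~ bad a -> forall x, `|x - a%:R / (p ^ e)%:R| <= rho ->
          (K * p)%:R `^ alpha <= monomial_discrepancy d x (K * p)]) ->
  forall (M : nat) (u l eps : R), 0 <= u -> 0 < l -> u + l <= 1 -> 0 < eps ->
    branching s (large_after alpha d M) u l eps.
Proof.
move=> d0 e0 k0 s01 hsig hbig H M u l eps u0 l0 ul1 eps0.
have [s0 s1] := andP s01.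
have l1 : l <= 1 by lra.
have [|C0 [w [w0 C00 HC]]] := H l; first by rewrite l0.
pose del := d%:R * (1 + k) - (e%:R + 1).
have del0 : 0 < del by rewrite subr_gt0.
have ds0 : 0 < d%:R * s by rewrite mulr_gt0 ?ltr0n.
(* In order, [c1] to [c5] secure [lY], [lYs], [rhoS], the bound [delta <= eps] and [mass] for
   [fractions_branching]. The first four are used as lower bounds for [Y], the last one through the
   mass inequality of [exists_parameters]. *)
pose c1 := 64 / l; pose c2 := (20 / l) `^ (1 - s)^-1 / l.
pose c3 := (64 * w / l) `^ del^-1; pose c4 := l / (32 * eps).
pose c5 := 16 * l `^ s / (l * (2 * w) `^ s).
have c10 : 0 <= c1 by rewrite divr_ge0 // ltW.
have c20 : 0 <= c2 by rewrite divr_ge0 ?powR_ge0 // ltW.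
have c30 : 0 <= c3 by exact: powR_ge0.
have c40 : 0 <= c4 by rewrite divr_ge0 ?mulr_ge0 ?(ltW l0) ?(ltW eps0).
have c50 : 0 <= c5 by rewrite divr_ge0 ?mulr_ge0 ?powR_ge0 ?(ltW l0).
pose C := 1 + C0 + c1 + c2 + c3 + c4 + c5 + M%:R.
have M0 : 0 <= M%:R :> R by [].
have C1 : 0 < C by rewrite /C; lra.
have [X [Y [K [Q [[uQ Q0] QP CY XK mass]]]]] := exists_parameters k0 ds0 C1 hsig.
have hY : 1 <= Y%:R :> R by move: CY; rewrite /C => CY; lra.
have hC0 : C0 <= Y%:R by move: CY; rewrite /C => CY; lra.
have h1 : c1 <= Y%:R by move: CY; rewrite /C => CY; lra.
have h2 : c2 <= Y%:R by move: CY; rewrite /C => CY; lra.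
have h3 : c3 <= Y%:R by move: CY; rewrite /C => CY; lra.
have h4 : c4 <= Y%:R by move: CY; rewrite /C => CY; lra.
have hM : M%:R <= Y%:R :> R by move: CY; rewrite /C => CY; lra.
have h5 : c5 <= C by rewrite /C; lra.
have Y0 : 0 < Y%:R :> R by lra.
have [p0 p0Q] : exists p, p \in Q by case: (Q) Q0 => // p Q' _; exists p; rewrite mem_head.
have YX : Y%:R <= X%:R :> R.
  by have [_ /ltnW h h'] := QP _ p0Q; rewrite ler_nat (leq_trans h).
have X0 : 0 < X%:R :> R by lra.
have K0 : 0 < K%:R :> R by apply: lt_le_trans XK; rewrite powR_gt0.
have K0n : (0 < K)%N by rewrite -(ltr0n R).
pose rho := w / (K%:R * X%:R) ^+ d.
have KX0 : 0 < K%:R * X%:R :> R by rewrite mulr_gt0.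
have KXd0 : 0 < (K%:R * X%:R) ^+ d :> R by rewrite exprn_gt0.
have rho0 : 0 < rho by rewrite divr_gt0.
have rhow : rho * (K%:R * X%:R) ^+ d <= w by rewrite /rho divfK ?gt_eqF.
have exb p : exists bad : pred nat, p \in Q ->
    (count bad (iota 0 (p ^ e)))%:R <= l / 4 * (p ^ e)%:R /\
    forall a, ~~ bad a -> forall x, `|x - a%:R / (p ^ e)%:R| <= rho ->
          (K * p)%:R `^ alpha <= monomial_discrepancy d x (K * p).
  case: (boolP (p \in Q)) => [pQ|_]; last by exists xpred0.
  have [pp Yp pX] := QP p pQ.
  have [|bad hb] := HC X K p rho pp pX _ XK rho0 rhow; last by exists bad.
  by apply: (le_trans hC0); rewrite ler_nat ltnW.
have [bad hbad] := choice exb.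
pose Sg : R := \sum_(p <- Q) (p ^ e)%:R.
have Sge : (size Q)%:R * Y%:R ^+ e <= Sg.
  rewrite /Sg -[(size Q)%:R]mulr1n -count_predT natr_count mulr_suml.
  rewrite big_seq [X in _ <= X]big_seq; apply: ler_sum => p /QP[pp Yp _].
  by rewrite mul1r -natrX ler_nat leq_pow2r // ltnW.
have Sle : Sg <= X%:R ^+ e.+1.
  apply: (@le_trans _ _ (\sum_(p <- Q) X%:R ^+ e)).
    rewrite /Sg big_seq [X in _ <= X]big_seq; apply: ler_sum => p /QP[pp _ pX].
    by rewrite -natrX ler_nat leq_pow2r.
  rewrite big_const_seq count_predT iter_addr_0 -[_ *+ size Q]mulr_natl exprS.
  rewrite ler_pM2r ?exprn_gt0 // ler_nat.
  rewrite -[X in (_ <= X)%N](size_iota 1); apply: uniq_leq_size => // p /QP[pp _ pX].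
  by rewrite mem_iota prime_gt0 //= add1n ltnS.
have YS : Y%:R <= Sg.
  apply: le_trans Sge; apply: (@le_trans _ _ (1 * Y%:R ^+ e)).
    by rewrite mul1r ler_eXnr.
  by rewrite ler_pM2r ?exprn_gt0 // ler1n.
have S0 : 0 < Sg by lra.
apply: (@fractions_branching R Q e bad u l rho Y%:R s uQ Q0 e0 _ u0 l0 ul1 rho0
  _ _ _ s01 _ _ (large_after alpha d M) eps).
- by move=> p /QP[? ? _]; rewrite ltr_nat.
- by move=> p pQ; have [] := hbad p pQ.
- by rewrite mulrC -ler_pdivrMr.
- rewrite -/Sg; apply: (@le_trans _ _ (64 * rho * X%:R ^+ e.+1)).
    by rewrite ler_pM2l // mulr_gt0.
  have hd : 64 * w / l <= X%:R `^ del.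
    apply: le_powR_of_root_le => //; last exact: le_trans YX.
    by rewrite divr_ge0 ?mulr_ge0 ?(ltW w0) ?(ltW l0).
  have hK : X%:R `^ del * X%:R ^+ e.+1 <= (K%:R * X%:R) ^+ d.
    rewrite -powR_mulrn ?(ltW X0) // -powRD; last by apply/implyP => _; rewrite gt_eqF.
    rewrite (_ : del + e.+1%:R = (k + 1) * d%:R); last by rewrite /del -natr1; ring.
    rewrite powRrM powR_mulrn ?powR_ge0 // ler_pXn2r ?nnegrE ?powR_ge0 ?(ltW KX0) //.
    rewrite powRD; last by apply/implyP => _; rewrite gt_eqF.
    by rewrite powRr1 ?(ltW X0) // ler_pM2r.
  have := ler_wpM2r (exprn_ge0 e.+1 (ltW X0)) hd; move=> /le_trans /(_ hK).
  rewrite /rho => hfin.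
  rewrite [X in X <= _](_ : _ = l * ((64 * w / l) * X%:R ^+ e.+1) / (K%:R * X%:R) ^+ d).
    by rewrite ler_pdivrMr // ler_pM2l.
  by field; rewrite !gt_eqF.
- rewrite -ler_pdivrMl // mulrC; apply: le_powR_of_root_le.
  + by rewrite divr_ge0 // ltW.
  + by rewrite mulr_ge0 // ltW.
  + by rewrite subr_gt0.
  + by move: h2; rewrite /c2 ler_pdivrMr // [_ * l]mulrC.
- rewrite -/Sg; pose Z := (K%:R * X%:R) `^ (d%:R * s).
  have Z0 : 0 < Z by rewrite powR_gt0.
  have w2 : 0 < (2 * w) `^ s by rewrite powR_gt0 // mulr_gt0.
  have E : (2 * rho) `^ s = (2 * w) `^ s / Z.
    rewrite /rho mulrA powRM ?mulr_ge0 ?invr_ge0 ?(ltW w0) ?(ltW KXd0) //.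
    congr (_ * _); rewrite -[_^-1]powR_inv1 ?(ltW KXd0) // -powRrM mulN1r powRN.
    by rewrite /Z powRrM powR_mulrn // ltW.
  have : c5 * Z <= Sg.
    apply: le_trans Sge; apply: le_trans mass; rewrite -/Z.
    by rewrite ler_pM2r.
  rewrite E /c5 => hc.
  rewrite (_ : 16 * l `^ s = l * (16 * l `^ s / (l * (2 * w) `^ s) * Z) * ((2 * w) `^ s / Z)).
    by rewrite ler_pM2r ?divr_gt0 // ler_pM2l.
  by field; rewrite !gt_eqF.
- rewrite -/Sg ler_pdivrMr ?mulr_gt0 //.
  have := le_trans h4 YS; rewrite /c4 ler_pdivrMr ?mulr_gt0 //; lra.
- move=> p a pQ ba x hx; have [pp Yp _] := QP p pQ; have [_ h] := hbad p pQ.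
  exists (K * p)%N; split; last exact: h ba _ hx.
    rewrite ler_nat in hM.
    apply: (leq_trans hM); apply: (leq_trans (ltnW Yp)).
    by rewrite leq_pmull.
  by rewrite muln_gt0 K0n prime_gt0.
Qed.

End Scales.

(** * Exceptional numerators in terms of the exponents *)

Section Cases.
Context {R : realType}.

Lemma arc_phase_le (d K p X : nat) (rho : R) : (p <= X)%N -> 0 <= rho ->
  arc_phase d rho (K * p) <= 8 * (rho * (K%:R * X%:R) ^+ d).
Proof.
move=> pX rho0; rewrite /arc_phase.
have h : ((K * p) ^ d)%:R <= (K%:R * X%:R) ^+ d :> R.
  by rewrite -natrM -natrX ler_nat leq_pow2r // leq_mul2l pX orbT.
have pi0 := @pi_ge0 R; have pi4 := @pi_lt4 R.
have : rho * ((K * p) ^ d)%:R <= rho * (K%:R * X%:R) ^+ d by rewrite ler_wpM2l.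
set A := _ * ((K * p) ^ d)%:R; set B := rho * _ => AB.
have A0 : 0 <= A by rewrite mulr_ge0.
by rewrite -mulrA -/A; nra.
Qed.

(* [K >= X^k] with [k (1 - alpha) > beta] makes [K^(1 - alpha)] exceed any
   multiple of [X^beta]. *)
Lemma powR_mul_le_of_large (alpha beta k c : R) (K p X : nat) :
  0 < alpha < 1 -> 0 <= beta -> 0 <= c -> beta < k * (1 - alpha) ->
  (0 < p)%N -> (p <= X)%N -> X%:R `^ k <= K%:R ->
  c `^ (k * (1 - alpha) - beta)^-1 <= X%:R ->
  c * (K * p)%:R `^ alpha <= K%:R * p%:R `^ (alpha - beta).
Proof.
move=> /andP[a0 a1] b0 c0 hk p0 pX XK hc.
have X0 : 0 < X%:R :> R by rewrite ltr0n (leq_trans p0).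
have K0 : 0 < K%:R :> R by apply: lt_le_trans XK; rewrite powR_gt0.
have p0' : 0 < p%:R :> R by rewrite ltr0n.
have split_powR (x r t : R) : 0 < x -> x `^ (r + t) = x `^ r * x `^ t.
  by move=> x0; rewrite powRD //; apply/implyP => _; rewrite gt_eqF.
have h1 : c * X%:R `^ beta <= X%:R `^ (k * (1 - alpha)).
  rewrite -[k * (1 - alpha)](subrK beta) split_powR // ler_pM2r ?powR_gt0 //.
  by apply: le_powR_of_root_le; rewrite ?subr_gt0 ?(ltW X0).
have h2 : X%:R `^ (k * (1 - alpha)) <= K%:R `^ (1 - alpha).
  rewrite powRrM; apply: ge0_ler_powR; rewrite ?nnegrE ?powR_ge0 ?(ltW K0) //.
  by rewrite subr_ge0 ltW.
have h3 : p%:R `^ beta <= X%:R `^ beta.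
  by apply: ge0_ler_powR; rewrite ?nnegrE ?(ltW X0) ?(ltW p0') // ler_nat.
have h4 : c * p%:R `^ beta <= K%:R `^ (1 - alpha).
  by apply: le_trans h2; apply: le_trans h1; rewrite ler_wpM2l.
rewrite natrM powRM ?(ltW K0) ?(ltW p0') //.
have pE : p%:R `^ alpha = p%:R `^ (alpha - beta) * p%:R `^ beta.
  by rewrite -split_powR // subrK.
have KE : K%:R = K%:R `^ (1 - alpha) * K%:R `^ alpha.
  by rewrite -split_powR // subrK powRr1 // ltW.
rewrite pE [X in _ <= X * _]KE.
have := ler_wpM2r (mulr_ge0 (powR_ge0 K%:R alpha) (powR_ge0 p%:R (alpha - beta))) h4.
lra.
Qed.

(** The share [l / 4] is split evenly: [8 / l <= p] makes the numerator 0 cost at most [l / 8], and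
    [w = l / 2560] makes [40 * 8 w] equal to [l / 8]. The term 3 in the threshold makes [p] odd. *)
Lemma exceptions_square (alpha k l : R) : 2^-1 < alpha < 1 ->
  alpha - 2^-1 < k * (1 - alpha) -> 0 < l <= 1 ->
  exists C w : R, [/\ 0 < w, 0 < C &
    forall (X K p : nat) (rho : R), prime p -> (p <= X)%N -> C <= p%:R ->
      X%:R `^ k <= K%:R -> 0 < rho -> rho * (K%:R * X%:R) ^+ 2 <= w ->
      exists bad : pred nat,
        (count bad (iota 0 (p ^ 1)))%:R <= l / 4 * (p ^ 1)%:R /\
        forall a, ~~ bad a -> forall x, `|x - a%:R / (p ^ 1)%:R| <= rho ->
          (K * p)%:R `^ alpha <= monomial_discrepancy 2 x (K * p)].
Proof.
move=> /andP[a2 a1] hk /andP[l0 l1].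
pose c := (64 : R) `^ (k * (1 - alpha) - (alpha - 2^-1))^-1.
have c0 : 0 <= c by exact: powR_ge0.
exists (3 + c + 8 / l), (l / 16 / 160); split.
- by lra.
- have : 0 < 8 / l by rewrite divr_gt0.
  by lra.
move=> X K p rho pp pX Cp XK rho0 hw.
have l8 : 0 <= 8 / l by rewrite divr_ge0 // ltW.
have p0 := prime_gt0 pp; have p0' : 0 < p%:R :> R by rewrite ltr0n.
have X0 : 0 < X%:R :> R by rewrite ltr0n (leq_trans p0).
have K0 : (0 < K)%N by rewrite -(ltr0n R); apply: lt_le_trans XK; rewrite powR_gt0.
have p3 : (3 <= p)%N by rewrite -(ler_nat R); lra.
have op : odd p by apply: contraLR p3 => /(prime_oddPn pp) ->.
rewrite expn1.
have ph := arc_phase_le 2 K pX (ltW rho0).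
have w16 : arc_phase 2 rho (K * p) <= 16^-1 by lra.
have weta : 40 * arc_phase 2 rho (K * p) <= l / 8 by lra.
have hkap : 1 <= l / 8 * p%:R.
  have : 8 / l <= p%:R by lra.
  rewrite ler_pdivrMr //; lra.
have [bad [hb hd]] := exceptions_prime_square pp op K0 (ltW rho0) w16 weta hkap.
exists bad; split; first by apply: (le_trans hb); lra.
move=> a ba x hx; apply: le_trans (hd a ba x hx).
rewrite ler_pdivlMr // mulrC.
have := @powR_mul_le_of_large alpha (alpha - 2^-1) k 64 K p X _ _ _ hk p0 pX XK _.
rewrite subKr powR12_sqrt ?(ltW p0') //; apply => //.
- by rewrite a1 (lt_trans _ a2) // invr_gt0.
- by rewrite subr_ge0 ltW.
- have : p%:R <= X%:R :> R by rewrite ler_nat.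
  by rewrite -/c; lra.
Qed.

(** An exponent above 1/2 forces [k > 1], so [K / X] is eventually at least [A]; then
    [4 d (1 / p + p / K) <= 8 d / A = l / 8], and [w] is chosen to make the phase term at most
    [l / 8]. The term [d] in the threshold gives [p > d], hence [p] prime to [d]. *)
Lemma exceptions_power (d : nat) (alpha k l : R) : (2 < d)%N ->
  2^-1 < alpha < 1 -> alpha < k * (1 - alpha) -> 0 < l <= 1 ->
  exists C w : R, [/\ 0 < w, 0 < C &
    forall (X K p : nat) (rho : R), prime p -> (p <= X)%N -> C <= p%:R ->
      X%:R `^ k <= K%:R -> 0 < rho -> rho * (K%:R * X%:R) ^+ d <= w ->
      exists bad : pred nat,
        (count bad (iota 0 (p ^ d)))%:R <= l / 4 * (p ^ d)%:R /\
        forall a, ~~ bad a -> forall x, `|x - a%:R / (p ^ d)%:R| <= rho ->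
          (K * p)%:R `^ alpha <= monomial_discrepancy d x (K * p)].
Proof.
move=> d2 /andP[a2 a1] hk /andP[l0 l1].
have k1 : 1 < k by nra.
have d0 : 0 < d%:R :> R by rewrite ltr0n; lia.
have d1 : 1 <= d%:R :> R by rewrite ler1n -(ltr0n R).
pose c := (128 : R) `^ (k * (1 - alpha) - alpha)^-1.
have c0 : 0 <= c by exact: powR_ge0.
pose A := 64 * d%:R / l.
have A0 : 0 < A by rewrite divr_gt0 // mulr_gt0.
pose c' := A `^ (k - 1)^-1.
have c'0 : 0 <= c' by exact: powR_ge0.
have w0 : 0 < l / (64 * (32 * (2 * d%:R + 1))) by apply: divr_gt0; [exact: l0|apply: mulr_gt0; lra].
exists (1 + d%:R + c + c' + A), (l / (64 * (32 * (2 * d%:R + 1)))); split => //; first lra.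
move=> X K p rho pp pX Cp XK rho0 hw.
have p0 := prime_gt0 pp; have p0' : 0 < p%:R :> R by rewrite ltr0n.
have pXR : p%:R <= X%:R :> R by rewrite ler_nat.
have X0 : 0 < X%:R :> R by lra.
have K0 : 0 < K%:R :> R by apply: lt_le_trans XK; rewrite powR_gt0.
have KX : A * X%:R <= K%:R.
  apply: le_trans XK; rewrite -[k](subrK 1) powRD; last by apply/implyP => _; rewrite gt_eqF.
  rewrite powRr1 ?(ltW X0) // ler_pM2r //; apply: le_powR_of_root_le; rewrite ?(ltW A0) ?(ltW X0) ?subr_gt0 //.
  by rewrite -/c'; lra.
have A1 : 1 <= A.
  rewrite /A ler_pdivlMr // mul1r.
  lra.
have pK : (p <= K)%N by rewrite -(ler_nat R); nra.
have pd : ~~ (p %| d)%N.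
  apply/negP => /dvdn_leq h; have : (p <= d)%N by apply: h; rewrite -(ltr0n R).
  rewrite -(ler_nat R); lra.
have ph := arc_phase_le d K pX (ltW rho0).
set B := arc_phase d rho (K * p) in ph.
have hB : B * (256 * (2 * d%:R + 1)) <= l.
  have : B <= 8 * (l / (64 * (32 * (2 * d%:R + 1)))) by lra.
  rewrite (_ : 8 * _ = l / (256 * (2 * d%:R + 1))); last by field; rewrite gt_eqF //; lra.
  by rewrite ler_pdivlMr //; lra.
have B0 : 0 <= B by rewrite /B /arc_phase !mulr_ge0 ?pi_ge0 // ltW.
have w16 : B <= 16^-1 by nra.
have weta : 32 * (2 * d%:R + 1) * B <= l / 8 by lra.
have [bad [hb hd]] := exceptions_prime_power pp d2 pd pK (ltW rho0) w16 weta.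
have hq : 0 < (p ^ d)%:R :> R by rewrite ltr0n expn_gt0 p0.
exists bad; split.
  apply: (le_trans hb); rewrite ler_pM2r //.
  have dA : 4 * d%:R * A^-1 = l / 16 by rewrite /A; field; rewrite !gt_eqF.
  have i1 : p%:R^-1 <= A^-1 by rewrite lef_pV2 ?posrE //; lra.
  have i2 : p%:R / K%:R <= A^-1.
    rewrite ler_pdivrMr // ler_pdivlMl //; apply: le_trans KX.
    by rewrite ler_pM2l.
  have := ler_wpM2l (ltW d0) (lerD i1 i2); lra.
move=> a ba x hx; apply: le_trans (hd a ba x hx).
have := @powR_mul_le_of_large alpha alpha k 128 K p X _ _ _ hk p0 pX XK _.
rewrite subrr powRr0 mulr1 => h.
suff : 128 * (K * p)%:R `^ alpha <= K%:R by lra.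
apply: h => //.
- by rewrite a1 (lt_trans _ a2) // invr_gt0.
- by rewrite (le_trans _ (ltW a2)) // invr_ge0.
- by rewrite -/c; lra.
Qed.

End Cases.

(** * From branching to the two dimension bounds *)

Section LargeDiscrepancySet.
Context {R : realType}.

Lemma torus_interval_segment (I : set R) : torus_interval I ->
  exists u l : R, [/\ 0 <= u, 0 < l, u + l < 1 &
    forall x, u <= x <= u + l -> I x].
Proof.
move=> [J [iJ [a [b [Ja Jb ab]]] ->]].
pose f : R := (Num.floor a)%:~R.
have fa : f <= a by exact: floor_le.
have af : a < f + 1 by have := floorD1_gt a; rewrite intrD.
(* Cutting at the next integer keeps the floor constant; halving the length keeps the right end
   strictly below 1 even for an arc through 0. *)
pose b' := Num.min b (f + 1).
have ab' : a < b' by rewrite lt_min ab af.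
have bb' : b' <= b by rewrite ge_min lexx.
have bf : b' <= f + 1 by rewrite ge_min lexx orbT.
exists (a - f), ((b' - a) / 2); split; [lra|lra|lra|].
move=> x /andP[x1 x2]; exists (x + f).
  by apply: (iJ a b) => //; apply/andP; split; lra.
have -> : x = (x + f) - f by ring.
rewrite /fracpart subrK; congr (_ - _%:~R).
by apply: floor_def; rewrite intrD -/f; apply/andP; split; lra.
Qed.

Lemma large_discrepancy_set_of_large_after (alpha : R) d x : 0 <= x < 1 ->
  (forall M, large_after alpha d M x) -> large_discrepancy_set alpha d x.
Proof.
move=> x01 h; split => // /finite_seqP[s sE].
have [N [MN N0 hN]] := h (\max_(i <- s) i).+1.
have : [set` s] N by rewrite -sE.
by move=> /= Ns; have := @leq_bigmax_seq _ s xpredT id N Ns isT; rewrite leqNgt MN.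
Qed.

Lemma branching_large_after_le (s alpha alpha' : R) d M u l eps : alpha <= alpha' ->
  branching s (large_after alpha' d M) u l eps ->
  branching s (large_after alpha d M) u l eps.
Proof.
move=> aa [cs [rho [delta [h1 h2 h3 h4 h5]]]].
exists cs, rho, delta; split => // c x ccs hx.
have [N [MN N0 hN]] := h4 c x ccs hx; exists N; split => //.
by apply: le_trans hN; apply: ler_powR => //; rewrite ler1n.
Qed.

Lemma hausdorff_dim_large_discrepancy_ge (alpha b : R) d (I : set R) :
  torus_interval I -> 0 < b ->
  (forall s, 0 < s < b -> forall M u l eps, 0 <= u -> 0 < l -> u + l <= 1 ->
    0 < eps -> branching s (large_after alpha d M) u l eps) ->
  (b%:E <= hausdorff_dim (large_discrepancy_set alpha d `&` I))%E.
Proof.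
move=> /torus_interval_segment[u0 [l0 [u00 l00 ul1 uI]]] b0 hbr.
apply: (@hausdorff_dim_ge R _ (large_after alpha d) u0 l0 b l00 b0).
  move=> s sb M u l eps lp uu ull e0; apply: hbr => //; first exact: le_trans uu.
  by apply: (le_trans ull); exact: ltW.
move=> x hx hM; split; last exact: uI.
apply: large_discrepancy_set_of_large_after => //.
by case/andP: hx => h1 h2; apply/andP; split; lra.
Qed.

Lemma branching_square (alpha s : R) M u l eps : 0 < alpha < 1 ->
  0 < s < Num.min 1 (2 * (1 - alpha)) -> 0 <= u -> 0 < l -> u + l <= 1 ->
  0 < eps -> branching s (large_after alpha 2 M) u l eps.
Proof.
move=> /andP[a0 a1] /andP[s0]; rewrite lt_min => /andP[s1 sa] u0 l0 ul1 e0.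
(* The bound [s < 1] makes room for [beta] above 1/2, and [s < 2 (1 - alpha)] for [beta] above
   [alpha]. *)
have [beta [b1 b2 b3]] : exists beta, [/\ alpha <= beta, 2^-1 < beta & s < 2 * (1 - beta)].
  exists ((Num.max alpha 2^-1 + (1 - s / 2)) / 2).
  have m1 : alpha <= Num.max alpha 2^-1 by rewrite le_max lexx.
  have m2 : 2^-1 <= Num.max alpha 2^-1 by rewrite le_max lexx orbT.
  have m3 : Num.max alpha 2^-1 < 1 - s / 2 by rewrite gt_max; apply/andP; split; lra.
  by split; lra.
have b4 : beta < 1 by lra.
have b5 : 0 < 1 - beta by lra.
(* The lower bound on [k] makes the discrepancy large enough, the upper one is the mass condition
   [2 s (1 + k) < 2]; they are compatible exactly when [s < 2 (1 - beta)]. *)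
have [k [k1 k2]] : exists k, (beta - 2^-1) / (1 - beta) < k /\ k < s^-1 - 1.
  have h : (beta - 2^-1) / (1 - beta) < s^-1 - 1.
    have -> : (beta - 2^-1) / (1 - beta) = (2 * (1 - beta))^-1 - 1.
      by field; rewrite gt_eqF.
    by rewrite ltrD2r ltf_pV2 ?posrE // mulr_gt0.
  by exists (((beta - 2^-1) / (1 - beta) + (s^-1 - 1)) / 2); split; lra.
rewrite ltr_pdivrMr // in k1.
have k0 : 0 < k by nra.
have sk : s * (1 + k) < 1 by rewrite -ltr_pdivlMl // mulr1; lra.
apply: (branching_large_after_le b1).
apply: (@branching_large_discrepancy R 2 1 beta k s) => //.
- by rewrite s0.
- by rewrite -mulrA; lra.
- by lra.
- by move=> l' hl'; apply: exceptions_square; rewrite ?b2.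
Qed.

Lemma branching_power (d : nat) (alpha s : R) M u l eps : (3 <= d)%N ->
  0 < alpha < 1 ->
  0 < s < (1 + d%:R^-1) * Num.min (2 / (d%:R + 2)) (1 - alpha) ->
  0 <= u -> 0 < l -> u + l <= 1 ->
  0 < eps -> branching s (large_after alpha d M) u l eps.
Proof.
move=> d3 /andP[a0 a1] /andP[s0 hs] u0 l0 ul1 e0.
have dR : 3 <= d%:R :> R by rewrite ler_nat.
pose c : R := 1 + d%:R^-1.
have c0 : 0 < c by rewrite addr_gt0 // invr_gt0; lra.
have c43 : c <= 4 / 3.
  have : d%:R^-1 <= 3^-1 :> R by rewrite lef_pV2 ?posrE //; lra.
  rewrite /c; lra.
have h1 : s / c < 1 - alpha.
  by rewrite ltr_pdivrMr // mulrC (lt_le_trans hs) // ler_pM2l // ge_min lexx orbT.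
(* From [2 / (d + 2) <= 2 / 5]. This gives [1 - s / c > 1/2], so [beta] can exceed 1/2, which forces
   [k > 1] below. *)
have h2 : s / c < 2 / 5.
  rewrite ltr_pdivrMr // mulrC (lt_le_trans hs) // ler_pM2l // ge_min.
  by rewrite ler_pdivrMr ?addr_gt0 //; lra.
have s1 : s < 1 by move: h2; rewrite ltr_pdivrMr //; lra.
have [beta [b1 b2 b3]] : exists beta, [/\ alpha <= beta, 2^-1 < beta & s / c < 1 - beta].
  exists ((Num.max alpha 2^-1 + (1 - s / c)) / 2).
  have m1 : alpha <= Num.max alpha 2^-1 by rewrite le_max lexx.
  have m2 : 2^-1 <= Num.max alpha 2^-1 by rewrite le_max lexx orbT.
  have m3 : Num.max alpha 2^-1 < 1 - s / c by rewrite gt_max; apply/andP; split; lra.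
  by split; lra.
have sc0 : 0 < s / c by rewrite divr_gt0.
have b4 : beta < 1 by lra.
have b5 : 0 < 1 - beta by lra.
(* The upper bound is the mass condition [d s (1 + k) < d + 1], since [d c = d + 1]. *)
have [k [k1 k2]] : exists k, beta / (1 - beta) < k /\ k < c / s - 1.
  have h : beta / (1 - beta) < c / s - 1.
    have -> : beta / (1 - beta) = (1 - beta)^-1 - 1 by field; rewrite gt_eqF.
    by rewrite ltrD2r -[c / s]invf_div ltf_pV2 ?posrE.
  by exists ((beta / (1 - beta) + (c / s - 1)) / 2); split; lra.
rewrite ltr_pdivrMr // in k1.
have k0 : 1 < k by nra.
have sk : s * (1 + k) < c by rewrite -ltr_pdivlMl // mulrC; lra.
have dc : d%:R * c = d%:R + 1 by rewrite /c; field; rewrite gt_eqF //; lra.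
apply: (branching_large_after_le b1).
have d0 : (0 < d)%N by exact: ltn_trans d3.
apply: (@branching_large_discrepancy R d d beta k s d0 d0 _ _ _ _ _ M u l eps u0 l0 ul1 e0).
- exact: lt_trans k0.
- by rewrite s0.
- by rewrite -mulrA -dc ltr_pM2l //; lra.
- by nra.
- by move=> l' hl'; apply: exceptions_power => //; rewrite ?b2.
Qed.

End LargeDiscrepancySet.

Theorem theorem1p12 (R : realType) (alpha : R) (I : set R)
    (halpha : 0 < alpha < 1) (hI : torus_interval I) :
  ((Num.min 1 (2 * (1 - alpha)))%:E
     <= hausdorff_dim (large_discrepancy_set alpha 2 `&` I))%E
  /\
  (forall d : nat, (3 <= d)%N ->
    (((1 + d%:R^-1) * Num.min (2 / (d%:R + 2)) (1 - alpha))%:E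
       <= hausdorff_dim (large_discrepancy_set alpha d `&` I))%E).
Proof.
have a1 : 0 < 1 - alpha by case/andP: halpha; rewrite subr_gt0.
split=> [|d d3]; apply: hausdorff_dim_large_discrepancy_ge => //.
- by rewrite lt_min ltr01 mulr_gt0.
- by move=> s hs *; exact: branching_square.
- by rewrite mulr_gt0 ?addr_gt0 ?invr_gt0 ?ltr0n ?lt_min ?a1 ?divr_gt0 ?addr_gt0 ?ltr0n //; lia.
- by move=> s hs *; exact: branching_power.
Qed.
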